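(* Let $\Phi$ be an almost total Turing functional. If $Y\in\mathsf{W2R}_{\lambda_\Phi}$, then there is some $X\in\mathsf{W2R}$ with $X\in\mathrm{dom}(\Phi)$ and $\Phi(X)=Y$.
   Context: $2^{<\omega}$ is the set of finite binary strings, $\preceq$ the prefix order; $\lambda$ is the uniform measure on $2^\omega$. A Turing functional $\Phi$ is a c.e. set of pairs $(\sigma,\tau)$ of strings such that whenever $(\sigma,\tau),(\sigma',\tau')\in\Phi$ and $\sigma\preceq\sigma'$, $\tau,\tau'$ are comparable; $\Phi^X$ is the maximal finite or infinite sequence extending every $\tau$ with $(\sigma,\tau)\in\Phi$ for some $\sigma\preceq X$; $\mathrm{dom}(\Phi)=\{X:\Phi^X\text{ infinite}\}$ and $\Phi(X)=\Phi^X$ there. $\Phi$ is almost total if $\lambda(\mathrm{dom}(\Phi))=1$; then $\lambda_\Phi(\sigma)=\lambda(\{X:\Phi^X\succeq\sigma\})$ defines a computable probability measure. For a computable measure $\mu$, $X\in\mathsf{W2R}_\mu$ iff $X\notin\bigcap_i\mathcal U_i$ for every uniformly effectively open sequence $(\mathcal U_i)$ of subsets of $2^\omega$ with $\lim_i\mu(\mathcal U_i)=0$; $\mathsf{W2R}=\mathsf{W2R}_\lambda$. *)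

(* Defs.v *)
From HB Require Import structures.
From mathcomp Require Import all_boot all_order all_algebra.
From mathcomp Require Import all_classical all_reals all_analysis.
Set Implicit Arguments. Unset Strict Implicit. Unset Printing Implicit Defensive.
Import Order.TTheory GRing.Theory Num.Theory.
Local Open Scope classical_set_scope.
Local Open Scope ring_scope.

(* Cantor pairing on nat (a bijection nat * nat -> nat). *)
Definition cpair (a b : nat) : nat := ((a + b) * (a + b).+1) %/ 2 + b.

(* Codes of unary partial recursive functions nat -> nat (Turing complete,
   using the pairing bijection to handle several arguments). *)
Inductive pcode : Type :=
| PZero | PSucc | PId | PFst | PSnd
| PPair of pcode & pcode
| PComp of pcode & pcode
| PPrec of pcode & pcode
| PMu of pcode.

Inductive peval : pcode -> nat -> nat -> Prop :=
| ev_zero x : peval PZero x 0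
| ev_succ x : peval PSucc x x.+1
| ev_id x : peval PId x x
| ev_fst a b : peval PFst (cpair a b) a
| ev_snd a b : peval PSnd (cpair a b) b
| ev_pair f g x a b : peval f x a -> peval g x b -> peval (PPair f g) x (cpair a b)
| ev_comp f g x y z : peval g x y -> peval f y z -> peval (PComp f g) x z
| ev_prec0 f g x y : peval f x y -> peval (PPrec f g) (cpair 0 x) y
| ev_precS f g n x y z :
    peval (PPrec f g) (cpair n x) y -> peval g (cpair n (cpair y x)) z ->
    peval (PPrec f g) (cpair n.+1 x) z
| ev_mu f x n :
    peval f (cpair n x) 0 ->
    (forall m, (m < n)%N -> exists k, peval f (cpair m x) k.+1) ->
    peval (PMu f) x n.

Definition halts (e : pcode) (x : nat) : Prop := exists y, peval e x y.

Definition ce_nat (A : nat -> Prop) : Prop := exists e, forall n, A n <-> halts e n.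

Definition str := seq bool.
Definition cantor := nat -> bool.

(* Bijective coding of finite binary strings by naturals. *)
Fixpoint code_str (s : str) : nat :=
  match s with
  | [::] => 0
  | b :: s' => (code_str s').*2 + 1 + b
  end.

Definition pre (s : str) (X : cantor) : Prop := mkseq X (size s) = s.

Definition cyl (s : str) : set cantor := [set X | pre s X].

Definition functional := str -> str -> Prop.

Definition ce_pairs (Phi : functional) : Prop :=
  ce_nat (fun n => exists s t, n = cpair (code_str s) (code_str t) /\ Phi s t).

Definition turing_functional (Phi : functional) : Prop :=
  ce_pairs Phi /\
  (forall s t s' t', Phi s t -> Phi s' t' -> prefix s s' ->
     prefix t t' || prefix t' t).

Definition in_dom (Phi : functional) (X : cantor) : Prop :=
  forall n, exists s t, Phi s t /\ pre s X /\ (n <= size t)%N.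

(* Y extends every tau with (sigma,tau) in Phi, sigma < X; for X in dom(Phi)
   this says exactly Phi(X) = Y. *)
Definition out_is (Phi : functional) (X Y : cantor) : Prop :=
  forall s t, Phi s t -> pre s X -> pre t Y.

Definition out_ext (Phi : functional) (X : cantor) (s : str) : Prop :=
  s = [::] \/ exists r t, Phi r t /\ pre r X /\ prefix s t.

Section Measures.
Variable R : realType.
Local Open Scope ereal_scope.

(* A measure on 2^omega given by its values on cylinders; the measure of an
   arbitrary set is given by the (Caratheodory) outer measure:
   inf of sum_k m(c_k) over countable covers by cylinders. *)
Definition mu_outer (m : str -> \bar R) (A : set cantor) : \bar R :=
  ereal_inf [set \sum_(0 <= k <oo) m (c k) | c in
     [set c : nat -> str | A `<=` \bigcup_k cyl (c k)]].

Definition lambda_cyl (s : str) : \bar R := ((2%:R : R) ^- size s)%:E.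

Definition almost_total (Phi : functional) : Prop :=
  mu_outer lambda_cyl (in_dom Phi) = 1.

Definition lambda_Phi (Phi : functional) (s : str) : \bar R :=
  mu_outer lambda_cyl [set X | out_ext Phi X s].

Definition eff_open (e : pcode) (i : nat) : set cantor :=
  [set X | exists s, halts e (cpair i (code_str s)) /\ pre s X].

Definition W2R (m : str -> \bar R) (X : cantor) : Prop :=
  forall e : pcode,
    (fun i => mu_outer m (eff_open e i)) @ \oo --> 0 ->
    ~ (forall i, eff_open e i X).

End Measures.

(* Main.v *)
Require Import Defs.
From HB Require Import structures.
From mathcomp Require Import all_boot all_order all_algebra.
From mathcomp Require Import all_classical all_reals all_analysis.
From mathcomp Require Import zify ring lra.
Set Implicit Arguments. Unset Strict Implicit. Unset Printing Implicit Defensive.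
Import Order.TTheory GRing.Theory Num.Theory.

(* Let [U_k] be a test with [lambda U_k -> 0], and let [B_k] be the union of the
   cylinders [w] such that [U_k] occupies a fraction larger than [2 ^- j] of the
   preimage of [w] under [Phi]. As [Phi] is almost total, [B_k] is uniformly
   effectively open, and the maximal inequality bounds its [lambda_Phi]-measure
   by [2 ^ j * lambda U_k]. Hence [Y] avoids some [B_k]: conditionally on each
   prefix of [Y], the set [U_k] has measure at most [2 ^- j]. Doing this for all
   tests, with fractions whose sum is less than [1], leaves inside the preimage
   of each prefix of [Y] a point outside the first chosen sets [U_k]; a limit of
   such points lies outside all of them and is mapped to [Y].

   Measures of clopen sets are computed by counting the strings of a given
   length, and the stages of an effectively open set are clopen; thus the
   comparison that defines [B_k] becomes a search for a stage where two counts
   satisfy an inequality. *)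

(** * Computable functions *)

Definition triang (n : nat) := (n * n.+1) %/ 2.

Lemma triangS n : triang n.+1 = triang n + n.+1.
Proof.
rewrite /triang (_ : n.+1 * n.+2 = n.+1 * 2 + n * n.+1); last by lia.
by rewrite divnMDl // addnC.
Qed.

Lemma leq_triang m n : m <= n -> triang m <= triang n.
Proof. by move=> mn; rewrite leq_div2r // leq_mul. Qed.

Lemma cpairE a b : cpair a b = triang (a + b) + b.
Proof. by []. Qed.

(** Successive codes run along the diagonals of constant sum: the second component grows until the
    first is exhausted, then the next diagonal starts with second component [0]. *)
Definition unpair_step (p : nat * nat) : nat * nat :=
  if p.1 is a.+1 then (a, p.2.+1) else (p.2.+1, 0).

Definition unpair (n : nat) := iter n unpair_step (0, 0).
Definition unpair1 (n : nat) := (unpair n).1.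
Definition unpair2 (n : nat) := (unpair n).2.

Lemma cpair_unpair n : cpair (unpair1 n) (unpair2 n) = n.
Proof.
rewrite /unpair1 /unpair2; elim: n => [|n IHn]; first by rewrite /cpair.
rewrite /unpair iterS -/(unpair n) -[in RHS]IHn /unpair_step.
case: (unpair n) => [[|a] b] /=; rewrite !cpairE.
  by rewrite !addn0 add0n triangS; lia.
by rewrite (addnS a b) (addSn a b); lia.
Qed.

(** The offset [b] is smaller than the gap [a + b + 1] to the next triangular number, so the code
    determines the diagonal [a + b] and then [b]. *)
Lemma cpair_inj a b c d : cpair a b = cpair c d -> a = c /\ b = d.
Proof.
wlog lesum : a b c d / a + b <= c + d.
  move=> H eqp; have [le|/ltnW le] := leqP (a + b) (c + d); first exact: H.
  by have [-> ->] := H c d a b le (esym eqp).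
rewrite !cpairE => eqp; have [lt|le] := ltnP (a + b) (c + d).
  by have := leq_triang lt; rewrite triangS; lia.
have eqs : a + b = c + d by lia.
by rewrite eqs in eqp; lia.
Qed.

Lemma unpair1K a b : unpair1 (cpair a b) = a.
Proof. by have [] := cpair_inj (cpair_unpair (cpair a b)). Qed.

Lemma unpair2K a b : unpair2 (cpair a b) = b.
Proof. by have [] := cpair_inj (cpair_unpair (cpair a b)). Qed.

(** * Evaluation of codes with bounded search *)

Definition obind0 (v : nat) (F : nat -> nat) := if v is y.+1 then F y else 0.

(* [run e w x] is [0] if the computation of [e] on [x] does not converge when
   every unbounded search is cut after [w] steps, and [y.+1] if it yields [y]. *)
Fixpoint run (e : pcode) (w x : nat) : nat :=
  match e with
  | PZero => 1
  | PSucc => x.+2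
  | PId => x.+1
  | PFst => (unpair1 x).+1
  | PSnd => (unpair2 x).+1
  | PPair f g =>
      obind0 (run f w x) (fun a => obind0 (run g w x) (fun b => (cpair a b).+1))
  | PComp f g => obind0 (run g w x) (run f w)
  | PPrec f g =>
      nat_rect (fun=> nat) (run f w (unpair2 x))
        (fun n v => obind0 v (fun y => run g w (cpair n (cpair y (unpair2 x)))))
        (unpair1 x)
  | PMu f =>
      let n := nat_rect (fun=> nat) 0
        (fun _ k => if 1 < run f w (cpair k x) then k.+1 else k) w in
      if run f w (cpair n x) == 1 then n.+1 else 0
  end.

(** The search performed by [run] on [PMu]. As results are shifted by one, [1 < r k] means a nonzero
    value; the candidate halts at the first zero or divergence, and the final test in [run] tells
    these apart. *)
Definition mu_search (r : nat -> nat) w :=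
  nat_rect (fun=> nat) 0 (fun _ k => if 1 < r k then k.+1 else k) w.

Lemma mu_search_le r w : mu_search r w <= w.
Proof. by elim: w => //= w IH; case: ifP => // _; exact: leqW. Qed.

Lemma mu_search_pos r w i : i < mu_search r w -> 1 < r i.
Proof.
elim: w => //= w IH; case: ifP => // r1.
by rewrite ltnS leq_eqVlt => /orP[/eqP -> //|]; exact: IH.
Qed.

Lemma mu_search_found r w n : r n = 1 -> (forall i, i < n -> 1 < r i) ->
  n <= w -> mu_search r w = n.
Proof.
move=> rn ri nw; suff -> : mu_search r w = minn w n by apply/minn_idPr.
elim: w {nw} => [|w IH] /=; first by rewrite min0n.
rewrite IH; case: (ltnP w n) => wn.
  by rewrite ri // (minn_idPl wn).
by rewrite rn /=; symmetry; apply/minn_idPr; exact: leqW.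
Qed.

(** For [PMu], the values before the zero that was found are defined and nonzero. They persist by
    induction, so the longer search halts at the same place. *)
Lemma run_mono e w w' x y : w <= w' -> run e w x = y.+1 -> run e w' x = y.+1.
Proof.
move=> ww'; elim: e x y => //=.
- move=> f IHf g IHg x y; case Ef : (run f w x) => [//|a] /=.
  by case Eg : (run g w x) => [//|b] /=; rewrite (IHf _ _ Ef) (IHg _ _ Eg).
- move=> f IHf g IHg x y; case Eg : (run g w x) => [//|b] /=.
  by rewrite (IHg _ _ Eg); exact: IHf.
- move=> f IHf g IHg x; elim: (unpair1 x) => [|n IH] y /=; first exact: IHf.
  case: (nat_rect _ (run f w _) _ n) IH => [|v] IH //=.
  by rewrite (IH _ erefl); exact: IHg.
move=> f IHf x y; rewrite -!/(mu_search _ _).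
set n := mu_search _ w; case: eqP => // rn [<-].
rewrite (@mu_search_found _ w' n) ?(IHf _ _ rn) //.
  move=> i /mu_search_pos; case E : (run f w _) => [|v] // v1.
  by rewrite (IHf _ _ E).
exact: leq_trans (mu_search_le _ _) ww'.
Qed.

Lemma run_monob e w w' x : w <= w' -> 0 < run e w x -> 0 < run e w' x.
Proof. by move=> ww'; case E : run => // _; rewrite (run_mono ww' E). Qed.

Lemma run_peval e w x y : run e w x = y.+1 -> peval e x y.
Proof.
elim: e x y => /=; try by move=> x y [<-]; constructor.
- by move=> x y [<-]; rewrite -{1}(cpair_unpair x); constructor.
- by move=> x y [<-]; rewrite -{1}(cpair_unpair x); constructor.
- move=> f IHf g IHg x y; case Ef : (run f w x) => [//|a] /=.
  by case Eg : (run g w x) => [//|b] /= [<-]; constructor; auto.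
- move=> f IHf g IHg x y; case Eg : (run g w x) => [//|b] /= Ef.
  by econstructor; eauto.
- move=> f IHf g IHg x; have := cpair_unpair x.
  move: (unpair1 x) (unpair2 x) => a b <-; elim: a => [|n IH] y /=.
    by move=> E; constructor; exact: IHf.
  case: (nat_rect _ _ _ n) IH => [//|v] /= IH E.
  by econstructor; [exact: IH|exact: IHg].
move=> f IHf x y; rewrite -!/(mu_search _ _).
set n := mu_search _ w; case: eqP => // rn [<-]; constructor; first exact: IHf.
move=> m /mu_search_pos; case E : (run f w _) => [|[|v]] // _.
by exists v; exact: IHf.
Qed.

(** Monotonicity provides one bound [w] that serves the finitely many computations up to the zero
    and also lets the search reach [n]. *)
Lemma peval_run_mu f x n :
  (exists w, run f w (cpair n x) = 1) ->
  (forall m, m < n -> exists k w, run f w (cpair m x) = k.+2) ->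
  exists w, run (PMu f) w x = n.+1.
Proof.
move=> [w0 rn] rm.
have [w [nw w0w rw]] : exists w, [/\ n <= w, w0 <= w &
    forall m, m < n -> 1 < run f w (cpair m x)].
  suff [w rw] : exists w, forall m, m < n -> 1 < run f w (cpair m x).
    exists (maxn w (maxn n w0)); split; [lia|lia|move=> m mn].
    have := rw _ mn; case E : (run f w _) => [|v] // v0.
    by rewrite (run_mono _ E) // leq_maxl.
  elim: n {rn} rm => [|n IH] rm; first by exists 0.
  have [w rw] := IH (fun m mn => rm m (ltnW mn)).
  have [k [w1 rw1]] := rm n (leqnn _).
  exists (maxn w w1) => m; rewrite ltnS leq_eqVlt => /orP[/eqP -> |mn].
    by rewrite (run_mono _ rw1) // leq_maxr.
  have := rw _ mn; case E : (run f w _) => [|v] // v0.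
  by rewrite (run_mono _ E) // leq_maxl.
exists w => /=; rewrite -!/(mu_search _ _).
by rewrite (@mu_search_found _ w n) ?(run_mono w0w rn).
Qed.

(* The induction is on the derivation, which also contains derivations under
   the existential of [ev_mu]; hence the hand-made fixpoint. *)
Fixpoint peval_run e x y (H : peval e x y) {struct H} : exists w, run e w x = y.+1.
Proof.
destruct H as [x|x|x|a b|a b|f g x a b H1 H2|f g x y z H1 H2|f g x y H1
  |f g n x y z H1 H2|f x n Hn Hm]; try by exists 0.
- by exists 0; rewrite /= unpair1K.
- by exists 0; rewrite /= unpair2K.
- have [w1 E1] := peval_run _ _ _ H1; have [w2 E2] := peval_run _ _ _ H2.
  exists (maxn w1 w2) => /=.
  by rewrite (run_mono _ E1) ?leq_maxl //= (run_mono _ E2) ?leq_maxr.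
- have [w1 E1] := peval_run _ _ _ H1; have [w2 E2] := peval_run _ _ _ H2.
  exists (maxn w1 w2) => /=.
  by rewrite (run_mono _ E1) ?leq_maxl //= (run_mono _ E2) ?leq_maxr.
- have [w1 E1] := peval_run _ _ _ H1; exists w1 => /=.
  by rewrite unpair1K unpair2K.
- have [w1 E1] := peval_run _ _ _ H1; have [w2 E2] := peval_run _ _ _ H2.
  exists (maxn w1 w2).
  have := run_mono (leq_maxl w1 w2) E1; have := run_mono (leq_maxr w1 w2) E2.
  by rewrite /= !unpair1K !unpair2K /= => Eg -> /=.
apply: peval_run_mu; first exact: peval_run Hn.
intros m mn; destruct (Hm m mn) as [k Hk]; exists k;
  exact: (peval_run _ _ _ Hk).
Qed.

Lemma peval_det e x y y' : peval e x y -> peval e x y' -> y = y'.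
Proof.
move=> /peval_run[w Hw] /peval_run[w' Hw'].
have := run_mono (leq_maxl w w') Hw.
by rewrite (run_mono (leq_maxr w w') Hw') => -[].
Qed.

Lemma haltsP e x : halts e x <-> exists w, 0 < run e w x.
Proof.
split=> [[y /peval_run[w E]]|[w]]; first by exists w; rewrite E.
by case E : run => [//|y] _; exists y; exact: run_peval E.
Qed.

(** * Closure properties of the computable functions *)

Definition computable (f : nat -> nat) := exists e, forall x, peval e x (f x).
Notation computableb b := (computable (fun x => nat_of_bool (b x))).

Lemma eq_computable f g : f =1 g -> computable f -> computable g.
Proof. by move=> fg [e He]; exists e => x; rewrite -fg. Qed.

Lemma computable_id : computable (fun x => x).
Proof. by exists PId; constructor. Qed.

Lemma computable_comp f g : computable f -> computable g ->
  computable (fun x => f (g x)).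
Proof. by move=> [e He] [e' He']; exists (PComp e e') => x; econstructor. Qed.

Lemma computable_succ f : computable f -> computable (fun x => (f x).+1).
Proof. by apply: computable_comp; exists PSucc; constructor. Qed.

Lemma computable_const n : computable (fun=> n).
Proof.
elim: n => [|n]; last exact: computable_succ.
by exists PZero; constructor.
Qed.

Lemma computable_unpair1 f : computable f ->
  computable (fun x => unpair1 (f x)).
Proof.
apply: computable_comp; exists PFst => x.
by rewrite -{1}(cpair_unpair x); constructor.
Qed.

Lemma computable_unpair2 f : computable f ->
  computable (fun x => unpair2 (f x)).
Proof.
apply: computable_comp; exists PSnd => x.
by rewrite -{1}(cpair_unpair x); constructor.
Qed.

Lemma computable_cpair f g : computable f -> computable g ->
  computable (fun x => cpair (f x) (g x)).
Proof. by move=> [e He] [e' He']; exists (PPair e e') => x; constructor. Qed.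

Lemma computable_comp2 h f g : computable (fun z => h (unpair1 z) (unpair2 z)) ->
  computable f -> computable g -> computable (fun x => h (f x) (g x)).
Proof.
move=> Hh Hf Hg; have := computable_comp Hh (computable_cpair Hf Hg).
by apply: eq_computable => x; rewrite unpair1K unpair2K.
Qed.

(* The argument of the step function is laid out as in [ev_precS]. *)
Lemma computable_nat_rect (N B : nat -> nat) (S : nat -> nat -> nat -> nat) :
  computable N -> computable B ->
  computable (fun z => S (unpair2 (unpair2 z)) (unpair1 z) (unpair1 (unpair2 z))) ->
  computable (fun x => nat_rect (fun=> nat) (B x) (S x) (N x)).
Proof.
move=> HN [b Hb] [s Hs].
suff [e He] : computable (fun z => nat_rect (fun=> nat) (B (unpair2 z))
    (S (unpair2 z)) (unpair1 z)).
  apply: (@computable_comp2 (fun n x => nat_rect (fun=> nat) (B x) (S x) n)) => //.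
    by exists e.
  exact: computable_id.
exists (PPrec b s) => z; have := cpair_unpair z.
move: (unpair1 z) (unpair2 z) => n x <-; elim: n => [|n IH] /=.
  by constructor.
econstructor; first exact: IH.
have := Hs (cpair n (cpair (nat_rect (fun=> nat) (B x) (S x) n) x)).
by rewrite !(unpair1K, unpair2K).
Qed.

Lemma computable_pred f : computable f -> computable (fun x => (f x).-1).
Proof.
apply: computable_comp.
apply: (@eq_computable (fun x => nat_rect (fun=> nat) 0 (fun n _ => n) x));
  first by case.
apply: (@computable_nat_rect id (fun=> 0) (fun _ n _ => n));
  first exact: computable_id.
  exact: computable_const.
by apply: computable_unpair1; exact: computable_id.
Qed.

Lemma computable_add f g : computable f -> computable g ->
  computable (fun x => f x + g x).
Proof.
move=> Hf Hg.
apply: (@eq_computable (fun x => nat_rect (fun=> nat) (g x) (fun=> S) (f x))).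
  by move=> x; elim: (f x) => //= n ->.
by apply: (@computable_nat_rect f g (fun _ _ => S)) => //;
  apply/computable_succ/computable_unpair1/computable_unpair2/computable_id.
Qed.

Lemma computable_sub f g : computable f -> computable g ->
  computable (fun x => f x - g x).
Proof.
move=> Hf Hg.
apply: (@eq_computable (fun x => nat_rect (fun=> nat) (f x) (fun=> predn) (g x))).
  by move=> x; elim: (g x) => [|n /= ->]; rewrite ?subn0 ?subnS.
by apply: (@computable_nat_rect g f (fun _ _ => predn)) => //;
  apply/computable_pred/computable_unpair1/computable_unpair2/computable_id.
Qed.

Lemma computable_mul f g : computable f -> computable g ->
  computable (fun x => f x * g x).
Proof.
move=> Hf Hg.
apply: (@eq_computable (fun x => nat_rect (fun=> nat) 0 (fun=> addn (g x)) (f x))).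
  by move=> x; elim: (f x) => //= n ->.
apply: (@computable_nat_rect f (fun=> 0) (fun x _ => addn (g x))) => //.
  exact: computable_const.
apply: computable_add;
  last by apply/computable_unpair1/computable_unpair2/computable_id.
by apply: (computable_comp Hg);
  apply/computable_unpair2/computable_unpair2/computable_id.
Qed.

Lemma computableb_leq f g : computable f -> computable g ->
  computableb (fun x => f x <= g x).
Proof.
move=> Hf Hg; apply: (@eq_computable (fun x => 1 - (f x - g x)));
  first by move=> x; lia.
by apply: computable_sub; [exact: computable_const|exact: computable_sub].
Qed.

Lemma computableb_and a b : computableb a -> computableb b ->
  computableb (fun x => a x && b x).
Proof.
move=> Ha Hb; apply: (@eq_computable (fun x => a x * b x));
  last exact: computable_mul.
by move=> x; rewrite mulnb.
Qed.

Lemma computableb_neg a : computableb a -> computableb (fun x => ~~ a x).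
Proof.
move=> Ha; apply: (@eq_computable (fun x => 1 - a x)); first by move=> x;
  case: (a x).
by apply: computable_sub => //; exact: computable_const.
Qed.

Lemma computableb_or a b : computableb a -> computableb b ->
  computableb (fun x => a x || b x).
Proof.
move=> Ha Hb; apply: (@eq_computable (fun x => ~~ (~~ a x && ~~ b x))).
  by move=> x; rewrite negb_and !negbK.
by apply/computableb_neg/computableb_and; exact: computableb_neg.
Qed.

Lemma computableb_eq f g : computable f -> computable g ->
  computableb (fun x => f x == g x).
Proof.
move=> Hf Hg; apply: (@eq_computable (fun x => (f x <= g x) && (g x <= f x))).
  by move=> x; rewrite eqn_leq.
by apply: computableb_and; exact: computableb_leq.
Qed.

Lemma computable_if a f g : computableb a -> computable f -> computable g ->
  computable (fun x => if a x then f x else g x).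
Proof.
move=> Ha Hf Hg; apply: (@eq_computable (fun x => a x * f x + ~~ a x * g x)).
  by move=> x; case: (a x); rewrite /= !(mul1n, mul0n, addn0).
by apply: computable_add; apply: computable_mul => //; exact: computableb_neg.
Qed.

Lemma computable_expn2 f : computable f -> computable (fun x => 2 ^ f x).
Proof.
move=> Hf.
apply: (@eq_computable (fun x => nat_rect (fun=> nat) 1 (fun _ n => n + n) (f x))).
  by move=> x; elim: (f x) => //= n ->; rewrite expnS mul2n addnn.
apply: (@computable_nat_rect f (fun=> 1) (fun _ _ n => n + n)) => //.
  exact: computable_const.
by apply: computable_add;
  apply/computable_unpair1/computable_unpair2/computable_id.
Qed.

Lemma computable_modn f g : computable f -> computable g ->
  computable (fun x => f x %% g x).
Proof.
move=> Hf Hg; apply: (@eq_computable (fun x => nat_rect (fun=> nat) 0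
    (fun _ r => if r.+1 == g x then 0 else r.+1) (f x))).
  move=> x; elim: (f x) => [|n /= ->]; first by rewrite mod0n.
  rewrite modnS; have [->|g0] := posnP (g x); first by rewrite dvd0n.
  have -> : (g x %| n.+1) = (g x %| (n %% g x).+1).
    by rewrite /dvdn -addn1 -modnDml addn1.
  have := ltn_pmod n g0; rewrite leq_eqVlt; case: eqP => [-> _|_ /= lt].
    by rewrite dvdnn.
  by rewrite gtnNdvd.
apply: (@computable_nat_rect f (fun=> 0)
  (fun x _ r => if r.+1 == g x then 0 else r.+1)) => //.
  exact: computable_const.
have Hr : computable (fun z => (unpair1 (unpair2 z)).+1).
  by apply/computable_succ/computable_unpair1/computable_unpair2/computable_id.
apply: computable_if => //; last exact: computable_const.
apply: computableb_eq => //.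
by apply: (computable_comp Hg);
  apply/computable_unpair2/computable_unpair2/computable_id.
Qed.

Lemma computable_sum N (F : nat -> nat -> nat) : computable N ->
  computable (fun z => F (unpair1 z) (unpair2 z)) ->
  computable (fun x => \sum_(0 <= i < N x) F x i).
Proof.
move=> HN HF.
apply: (@eq_computable (fun x => nat_rect (fun=> nat) 0 (fun n s => s + F x n) (N x))).
  move=> x; elim: (N x) => [|n /= ->]; first by rewrite big_geq.
  by rewrite big_nat_recr.
apply: (@computable_nat_rect N (fun=> 0) (fun x n s => s + F x n)) => //.
  exact: computable_const.
apply: computable_add;
  first by apply/computable_unpair1/computable_unpair2/computable_id.
by apply: computable_comp2 HF _ _;
  [apply/computable_unpair2/computable_unpair2/computable_id|
  apply/computable_unpair1/computable_id].
Qed.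

Lemma computableb_has N (P : nat -> nat -> bool) : computable N ->
  computableb (fun z => P (unpair1 z) (unpair2 z)) ->
  computableb (fun x => has (P x) (iota 0 (N x))).
Proof.
move=> HN HP; apply: (@eq_computable (fun x => 0 < \sum_(0 <= i < N x) P x i)).
  move=> x; congr nat_of_bool; rewrite lt0n sum_nat_seq_neq0.
  by rewrite /index_iota subn0; apply: eq_has => i /=; rewrite eqb0 negbK.
by apply: computableb_leq; [exact: computable_const|exact: computable_sum].
Qed.

Lemma computable_obind0 (V : nat -> nat) (F : nat -> nat ->
  nat) : computable V ->
  computable (fun z => F (unpair1 z) (unpair2 z)) ->
  computable (fun x => obind0 (V x) (F x)).
Proof.
move=> HV HF;
  apply: (@eq_computable (fun x => if V x == 0 then 0 else F x (V x).-1)).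
  by move=> x; case: (V x).
apply: computable_if; [by apply: computableb_eq => //;
  exact: computable_const|exact: computable_const|].
by apply: computable_comp2 HF _ _;
  [exact: computable_id|exact: computable_pred].
Qed.

Ltac computable_step :=
  match goal with
  | |- computable unpair1 => exact: (computable_unpair1 computable_id)
  | |- computable unpair2 => exact: (computable_unpair2 computable_id)
  | |- computable (fun x => x) => exact: computable_id
  | |- computable (fun=> _) => exact: computable_const
  | |- computable (fun x => (@?f x).+1) => apply: computable_succ
  | |- computable (fun x => (@?f x).-1) => apply: computable_pred
  | |- computable (fun x => unpair1 (@?f x)) => apply: computable_unpair1
  | |- computable (fun x => unpair2 (@?f x)) => apply: computable_unpair2
  | |- computable (fun x => cpair (@?f x) (@?g x)) => apply: computable_cpair
  | |- computable (fun x => @?f x + @?g x) => apply: computable_add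
  | |- computable (fun x => @?f x - @?g x) => apply: computable_sub
  | |- computable (fun x => @?f x * @?g x) => apply: computable_mul
  | |- computable (fun x => 2 ^ @?f x) => apply: computable_expn2
  | |- computable (fun x => @?f x %% @?g x) => apply: computable_modn
  | |- computable (fun x => nat_of_bool (@?a x || @?b x)) =>
      apply: computableb_or
  | |- computable (fun x => nat_of_bool (@?a x && @?b x)) =>
      apply: computableb_and
  | |- computable (fun x => nat_of_bool (~~ @?a x)) => apply: computableb_neg
  | |- computable (fun x => nat_of_bool (@?f x == @?g x)) =>
      apply: computableb_eq
  | |- computable (fun x => nat_of_bool (@?f x <= @?g x)) =>
      apply: computableb_leq
  | |- computable (fun x => nat_of_bool (has (@?P x) (iota 0 (@?N x)))) =>
      apply: computableb_has
  | H : computable ?f |- computable (fun x => ?f (@?g x)) =>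
      apply: (computable_comp H)
  | |- computable _ => assumption
  end.
Ltac computable_tac := repeat computable_step.

(** The code [e] stays fixed; the induction on it builds a program whose inputs are the search bound
    and the argument. All stage predicates below get their decidability from here. *)
Lemma computable_run e W X : computable W -> computable X ->
  computable (fun z => run e (W z) (X z)).
Proof.
elim: e W X => /=; try by move=> W X HW HX; computable_tac.
- move=> f IHf g IHg W X HW HX; apply: computable_obind0; first exact: IHf.
  by apply: computable_obind0; [apply: IHg|]; computable_tac.
- move=> f IHf g IHg W X HW HX; apply: computable_obind0; first exact: IHg.
  by apply: IHf; computable_tac.
- move=> f IHf g IHg W X HW HX; apply: computable_nat_rect.
  + by computable_tac.
  + by apply: IHf; computable_tac.
  + by apply: computable_obind0; [|apply: IHg]; computable_tac.
move=> f IHf W X HW HX.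
have Hs : computable
    (fun x => mu_search (fun k => run f (W x) (cpair k (X x))) (W x)).
  apply: computable_nat_rect; [by []|by computable_tac|].
  by apply: computable_if; computable_tac; apply: IHf; computable_tac.
by apply: computable_if; computable_tac; apply: IHf; computable_tac.
Qed.

(** An unbounded search for the witness halts exactly when there is one. This produces the codes of
    all tests constructed later. *)
Lemma computable_sigma1 (P : nat -> nat -> bool) :
  computableb (fun z => P (unpair1 z) (unpair2 z)) ->
  exists e, forall x, halts e x <-> exists w, P x w.
Proof.
move=> HP.
(* [PMu] looks for a zero and varies the first component of the pair, hence the negation and the
   exchanged arguments. *)
have [f Hf] : computableb (fun z => ~~ P (unpair2 z) (unpair1 z)).
  apply: computableb_neg;
    apply: (computable_comp2 (h := fun x w => nat_of_bool (P x w))) => //.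
    by computable_tac.
  by computable_tac.
exists (PMu f) => x; split=> [[n Hn]|[w Pw]].
  have : peval f (cpair n x) 0 by inversion Hn; subst.
  move=> /(peval_det (Hf _)); rewrite unpair1K unpair2K => /eqP.
  by rewrite eqb0 negbK; exists n.
have exP : exists w, P x w by exists w.
case: (ex_minnP exP) => n Pn minn; exists n; constructor.
  by have := Hf (cpair n x); rewrite unpair1K unpair2K Pn.
move=> m mn; exists 0; have := Hf (cpair m x); rewrite unpair1K unpair2K.
by case: (boolP (P x m)) => // /minn; rewrite leqNgt mn.
Qed.

(** * Codes of strings *)

(* A string of length [m] is identified with the number below [2 ^ m] whose
   binary digits it lists, least significant first; [initial m X] is the one of
   the first [m] bits of [X]. *)
Definition initial (m : nat) (X : cantor) := \sum_(0 <= i < m) X i * 2 ^ i.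

Lemma initialS m X : initial m.+1 X = initial m X + X m * 2 ^ m.
Proof. by rewrite /initial big_nat_recr. Qed.

Lemma initial_lt m X : initial m X < 2 ^ m.
Proof.
elim: m => [|m IH]; first by rewrite /initial big_geq.
by rewrite initialS expnS; case: (X m); lia.
Qed.

Lemma initial_mod m M X : m <= M -> initial M X %% 2 ^ m = initial m X.
Proof.
move=> /subnK <-; elim: (M - m) => [|k IH]; first exact/modn_small/initial_lt.
by rewrite addSn initialS expnD mulnA addnC modnMDl.
Qed.

Lemma initial_surj m y : y < 2 ^ m -> exists X, initial m X = y.
Proof.
move=> ym; exists (fun i => odd (y %/ 2 ^ i)).
suff -> : forall k, initial k (fun i => odd (y %/ 2 ^ i)) = y %% 2 ^ k.
  exact: modn_small.
elim=> [|k IH]; first by rewrite expn0 modn1 /initial big_geq.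
rewrite initialS IH.
have yE : y = (y %/ 2 ^ k)./2 * 2 ^ k.+1 + (y %% 2 ^ k + odd (y %/ 2 ^ k) * 2 ^ k).
  rewrite {1}(divn_eq y (2 ^ k)) -{1}(odd_double_half (y %/ 2 ^ k)) expnS; nia.
have -> := congr1 (modn^~ (2 ^ k.+1)) yE.
rewrite modnMDl [RHS]modn_small // expnS.
have : y %% 2 ^ k < 2 ^ k by rewrite ltn_pmod ?expn_gt0.
by case: odd; lia.
Qed.

Lemma initial_eq m X X' : (forall i, i < m -> X i = X' i) ->
  initial m X = initial m X'.
Proof. by move=> XX'; rewrite /initial !big_mkord; apply: eq_bigr => i _;
  rewrite XX'. Qed.

(** * Codes of strings in binary notation *)

Lemma code_str_rcons s b : code_str (rcons s b) = code_str s + 2 ^ size s * b.+1.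
Proof. by elim: s => [|a s /= ->]; [case: b|rewrite expnS /=; lia]. Qed.

(** Adding one to a code gives ordinary binary notation: the bits of the string, least significant
    first, topped by a leading digit [1]. *)
Lemma code_mkseq n X : (code_str (mkseq X n)).+1 = 2 ^ n + initial n X.
Proof.
elim: n => [|n IH]; first by rewrite /initial big_geq.
by rewrite mkseqS code_str_rcons size_mkseq initialS expnS; nia.
Qed.

Lemma code_str_inj : injective code_str.
Proof. by elim=> [|a s IH] [|b t] //=; [lia|lia|]; case: a; case: b => /= E;
  try lia; congr (_ :: _); apply: IH; lia. Qed.

Lemma mkseq_nth_size (s : str) : mkseq (nth false s) (size s) = s.
Proof. exact: mkseq_nth. Qed.

(** The position of the leading digit of [r.+1], that is, the length of the string coded by [r]. *)
Definition clen (r : nat) := trunc_log 2 r.+1.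

Lemma clen_code s : clen (code_str s) = size s.
Proof.
rewrite -{1}(mkseq_nth_size s) /clen code_mkseq; apply: trunc_log_eq => //.
by rewrite leq_addr expnS mul2n -addnn ltn_add2l initial_lt.
Qed.

Lemma clen_le r : clen r <= r.
Proof. by rewrite -ltnS;
  apply: leq_trans (ltn_expl _ (ltnSn 1)) (trunc_logP _ _). Qed.

Lemma code_str_surj n : exists s, code_str s = n.
Proof.
have [X HX] : exists X, initial (clen n) X = n.+1 - 2 ^ clen n.
  apply: initial_surj; have := trunc_log_ltn n.+1 (ltnSn 1).
  by have := trunc_logP (ltnSn 1) (ltn0Sn n); rewrite /clen expnS; lia.
exists (mkseq X (clen n)); apply: succn_inj; rewrite code_mkseq HX subnKC //.
exact: trunc_logP.
Qed.

(** The lowest digits of [x], which stand for the first bits, are compared with the string coded by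
    [r]. *)
Definition cpre (r x : nat) := r.+1 == 2 ^ clen r + x %% 2 ^ clen r.

Lemma cpreP s m X : size s <= m -> cpre (code_str s) (initial m X) <-> pre s X.
Proof.
move=> sm; rewrite /cpre clen_code initial_mod // -code_mkseq eqSS; split.
  by move=> /eqP /code_str_inj; rewrite /pre => <-.
by rewrite /pre => ->.
Qed.

Lemma cpre_mod r m x : r <= m -> cpre r (x %% 2 ^ m) = cpre r x.
Proof.
move=> rm; rewrite /cpre modn_dvdm // dvdn_exp2l //.
exact: leq_trans (clen_le r) rm.
Qed.

(** Subtracting [2 ^ clen t] removes the leading digit and leaves the bits of the string coded by
    [t]. *)
Definition cprefix (s t : nat) := (clen s <= clen t) && cpre s (t.+1 - 2 ^ clen t).

Lemma cprefixE s t : cprefix (code_str s) (code_str t) = prefix s t.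
Proof.
rewrite /cprefix !clen_code.
have -> : (code_str t).+1 - 2 ^ size t = initial (size t) (nth false t).
  by rewrite -{1}(mkseq_nth_size t) code_mkseq addKn.
rewrite prefixE; case: leqP => /= [st|ts].
  have tE : mkseq (nth false t) (size s) = take (size s) t.
    by rewrite -[in RHS](mkseq_nth_size t) -map_take take_iota (minn_idPl st).
  apply/idP/eqP => [/(cpreP _ st)|H]; first by rewrite /pre tE.
  by apply/cpreP; rewrite // /pre tE.
by rewrite take_oversize ?(ltnW ts) //; apply/esym/eqP => E;
  rewrite E ltnn in ts.
Qed.

(** The logarithm as a primitive recursion: it grows by one exactly when the next power of two is
    reached. *)
Definition clen_step (n l : nat) := if 2 ^ l.+1 <= n.+2 then l.+1 else l.

Lemma clen_rec r : clen r = nat_rect (fun=> nat) 0 clen_step r.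
Proof.
elim: r => [|n /= <-] //; rewrite /clen_step /clen.
have := trunc_logP (ltnSn 1) (ltn0Sn n); have := trunc_log_ltn n.+1 (ltnSn 1).
set l := trunc_log 2 n.+1 => lt ge; have l0 : 0 < 2 ^ l by rewrite expn_gt0.
apply: trunc_log_eq => //.
by move: lt; rewrite !expnS; case: (leqP (2 * 2 ^ l) n.+2); rewrite ?expnS; lia.
Qed.

Lemma computable_clen f : computable f -> computable (fun x => clen (f x)).
Proof.
apply: computable_comp; apply: (eq_computable (fun r => esym (clen_rec r))).
apply: (@computable_nat_rect id (fun=> 0) (fun=> clen_step)).
- exact: computable_id.
- exact: computable_const.
by rewrite /clen_step; apply: computable_if; computable_tac.
Qed.

Lemma computableb_cpre f g : computable f -> computable g ->
  computableb (fun z => cpre (f z) (g z)).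
Proof.
by move=> Hf Hg; rewrite /cpre; computable_tac; exact: computable_clen.
Qed.

Lemma computableb_cprefix f g : computable f -> computable g ->
  computableb (fun z => cprefix (f z) (g z)).
Proof.
move=> Hf Hg; rewrite /cprefix; computable_tac; try exact: computable_clen.
by apply: computableb_cpre => //; computable_tac; exact: computable_clen.
Qed.

Local Open Scope classical_set_scope.
Local Open Scope ring_scope.

(** * The uniform measure *)

(** Koenig's lemma: a string that extends to a point of every [C n] has a one-bit extension with the
    same property. The sets are arbitrary, so the limit is only approximated by their members. *)
Lemma cantor_compact (C : nat -> set cantor) :
  (forall n, C n.+1 `<=` C n) -> (forall n, C n !=set0) ->
  exists X, forall n, exists2 X', C n X' & forall i, (i < n)%N -> X i = X' i.
Proof.
move=> Cdec Cn0.
have Cle m n : (m <= n)%N -> C n `<=` C m.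
  by move=> /subnK <-; elim: (n - m)%N => // k IH X /Cdec /IH.
pose good s := forall n, exists2 X, C n X & pre s X.
pose next s := if `[< good (rcons s true) >] then rcons s true else rcons s false.
pose path n := iter n next [::].
have sz n : size (path n) = n.
  by elim: n => // n IH; rewrite /path iterS /next; case: ifP;
    rewrite size_rcons IH.
have goodp n : good (path n).
  elim: n => [n|n IH]; first by have [X CX] := Cn0 n; exists X.
  rewrite /path iterS -/(path n) /next;
    case: asboolP => // /existsNP[N Nbad] n'.
  (* The extension by [true] misses [C N]. A point of the smaller set [C (maxn N n')] on the path
     therefore continues with [false], and it lies in [C n'] as well. *)
  have [X CX pX] := IH (maxn N n').
  exists X; first exact: Cle (leq_maxr _ _) _ CX.
  rewrite /pre size_rcons sz mkseqS; rewrite /pre sz in pX; rewrite pX.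
  case E : (X n) => //; case: Nbad; exists X;
    first exact: Cle (leq_maxl _ _) _ CX.
  by rewrite /pre size_rcons sz mkseqS pX E.
have nthp i n : (i < n)%N -> nth false (path n) i = nth false (path i.+1) i.
  elim: n => // n IH; rewrite ltnS leq_eqVlt => /orP[/eqP -> //|lt].
  rewrite -IH // /path iterS -/(path n) /next.
  by case: ifP; rewrite nth_rcons sz lt.
exists (fun i => nth false (path i.+1) i) => n.
have [X CX pX] := goodp n n; exists X => // i lt.
by rewrite -(nthp _ _ lt) -pX nth_mkseq ?sz.
Qed.

Definition dec (n : nat) : str := projT1 (cid (code_str_surj n)).

Lemma decK n : code_str (dec n) = n.
Proof. exact: projT2 (cid (code_str_surj n)). Qed.

Lemma code_strK s : dec (code_str s) = s.
Proof. by apply: code_str_inj; rewrite decK. Qed.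

Lemma size_dec n : size (dec n) = clen n.
Proof. by rewrite -clen_code decK. Qed.

(** * Outer measures given by values on cylinders *)

Section OuterMeasure.
Context {R : realType}.
Local Open Scope ereal_scope.
Implicit Types (mu : str -> \bar R) (A B : set cantor).

Lemma mu_outer_mono mu A B : A `<=` B -> mu_outer mu A <= mu_outer mu B.
Proof.
move=> AB; apply: le_ereal_inf => _ [c Bc <-]; exists c => //.
exact: subset_trans AB Bc.
Qed.

Lemma mu_outer_ge0 mu A : (forall s, 0 <= mu s) -> 0 <= mu_outer mu A.
Proof.
by move=> mu0; apply: le_ereal_inf_tmp => _ [c _ <-]; exact: nneseries_ge0.
Qed.

(* Strings of arbitrarily small measure pad a partial cover to a full sequence
   of cylinders. *)
Lemma mu_outer_le_cover mu A (b : pred nat) :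
  (forall s, 0 <= mu s) -> (forall d : R, (0 < d)%R -> exists s, mu s <= d%:E) ->
  A `<=` [set X | exists2 n, b n & pre (dec n) X] ->
  mu_outer mu A <= \sum_(0 <= n <oo) (if b n then mu (dec n) else 0).
Proof.
move=> mu0 mu_small Ab; apply/lee_addgt0Pr => e e0.
have pad n : {s | mu s <= (e / (2 ^ n.+1)%:R)%:E}.
  by apply: cid; apply: mu_small; rewrite divr_gt0 // ltr0n expn_gt0.
pose c n := if b n then dec n else projT1 (pad n).
apply: (@le_trans _ _ (\sum_(0 <= n <oo) mu (c n))).
  apply: ereal_inf_lbound; exists c => // X /Ab[n bn pX].
  by exists n => //; rewrite /cyl /c bn.
apply: le_trans (epsilon_trick _ _ (ltW e0)); last by move=> n; case: ifP.
apply: lee_nneseries => // n _; rewrite /c; case: ifP => _.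
  by rewrite leeDl // lee_fin divr_ge0 // ltW.
by rewrite add0e; exact: projT2 (pad n).
Qed.

Lemma mu_outerU mu A B : (forall s, 0 <= mu s) ->
  mu_outer mu (A `|` B) <= mu_outer mu A + mu_outer mu B.
Proof.
move=> mu0; have A0 := mu_outer_ge0 A mu0; have B0 := mu_outer_ge0 B mu0.
have [Af|] := boolP (mu_outer mu A \is a fin_num); last first.
  rewrite ge0_fin_numE // -leNgt leye_eq => /eqP ->.
  by rewrite addye ?leey // gt_eqF // (lt_le_trans _ B0).
have [Bf|] := boolP (mu_outer mu B \is a fin_num); last first.
  rewrite ge0_fin_numE // -leNgt leye_eq => /eqP ->.
  by rewrite addey ?leey // gt_eqF // (lt_le_trans _ A0).
apply/lee_addgt0Pr => e e0; have e20 : (0 < e / 2)%R by rewrite divr_gt0.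
have [_ [c1 Ac1 <-] lt1] := lb_ereal_inf_adherent e20 Af.
have [_ [c2 Bc2 <-] lt2] := lb_ereal_inf_adherent e20 Bf.
(* The two covers are interleaved. *)
pose c k := if odd k then c2 k./2 else c1 k./2.
apply: (@le_trans _ _ (\sum_(0 <= k <oo) mu (c k))).
  apply: ereal_inf_lbound; exists c => // X [/Ac1|/Bc2] [k _ ck].
    by exists k.*2; rewrite // /cyl /c odd_double doubleK.
  by exists k.*2.+1; rewrite // /cyl /c /= odd_double uphalf_double.
apply: (@le_trans _ _ (\sum_(0 <= k <oo) mu (c1 k) + \sum_(0 <= k <oo) mu (c2 k))).
  apply: lime_le; first exact: is_cvg_nneseries.
  apply: nearW => n; apply: (@le_trans _ _ (\sum_(0 <= k < n.*2) mu (c k))).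
    by apply: lee_sum_nneg_natr => //; rewrite -addnn leq_addr.
  apply: (@le_trans _ _ (\sum_(0 <= k < n) mu (c1 k) + \sum_(0 <= k < n) mu (c2 k))).
    rewrite le_eqVlt; apply/orP; left; apply/eqP.
    elim: n => [|n IH]; first by rewrite !big_geq // adde0.
    rewrite doubleS !big_nat_recr //= IH /c /= odd_double doubleK uphalf_double.
    by rewrite addeACA !addeA.
  by apply: leeD; exact: nneseries_lim_ge.
apply: le_trans (leeD (ltW lt1) (ltW lt2)) _.
by rewrite addeACA -EFinD -splitr.
Qed.

End OuterMeasure.

(** * Counting strings of a given length *)

Definition cnt (m : nat) (p : pred nat) : nat := (\sum_(0 <= x < 2 ^ m) p x)%N.

Lemma eq_cnt m (p q : pred nat) : (forall x, (x < 2 ^ m)%N -> p x = q x) ->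
  cnt m p = cnt m q.
Proof. by move=> pq; apply: eq_big_nat => x /= xm; rewrite pq. Qed.

Lemma leq_cnt m (p q : pred nat) : (forall x, (x < 2 ^ m)%N -> p x -> q x) ->
  (cnt m p <= cnt m q)%N.
Proof.
move=> pq; rewrite /cnt !big_mkord; apply: leq_sum => i _.
by have := pq i (ltn_ord i); case: (p i) => // /(_ isT) ->.
Qed.

Lemma cntS m (p : pred nat) :
  cnt m.+1 p = (cnt m p + cnt m (fun x => p (x + 2 ^ m)))%N.
Proof.
rewrite /cnt expnS mul2n -addnn (big_cat_nat (n := (2 ^ m)%N)) ?leq_addr //=.
by congr addn; rewrite -{1}[(2 ^ m)%N]add0n big_addn addnK.
Qed.

(** Each string of length [m] has [2 ^ (M - m)] extensions of length [M]. *)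
Lemma cnt_mod m M (p : pred nat) : (m <= M)%N ->
  cnt M (fun x => p (x %% 2 ^ m)%N) = (2 ^ (M - m) * cnt m p)%N.
Proof.
move=> mM; rewrite -{1}(subnK mM); elim: (M - m)%N => [|k IH].
  by rewrite mul1n; apply: eq_cnt => x xm; rewrite modn_small.
rewrite addSn cntS IH expnS mul2n -addnn mulnDl; congr addn; rewrite -IH.
by apply: eq_cnt => x _; rewrite expnD addnC modnMDl.
Qed.

Lemma cnt_pred1 m c : (c < 2 ^ m)%N -> cnt m (eq_op^~ c) = 1%N.
Proof.
move=> cm; rewrite /cnt (bigD1_seq c) ?iota_uniq ?mem_index_iota //=.
by rewrite eqxx big1 // => i /negbTE ->.
Qed.

Lemma cntT m : cnt m xpredT = (2 ^ m)%N.
Proof. by rewrite /cnt sum1_size size_iota subn0. Qed.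

Lemma cnt_cpre r m : (clen r <= m)%N -> cnt m (cpre r) = (2 ^ (m - clen r))%N.
Proof.
move=> rm; have := trunc_logP (ltnSn 1) (ltn0Sn r).
have := trunc_log_ltn r.+1 (ltnSn 1); rewrite -/(clen r) expnS => lt ge.
rewrite (@eq_cnt _ _ (fun x => (x %% 2 ^ clen r)%N == (r.+1 - 2 ^ clen r)%N)).
  by rewrite (cnt_mod (eq_op^~ _)) // cnt_pred1 ?muln1 //; lia.
by move=> x _; rewrite /cpre; apply/eqP/eqP; lia.
Qed.

Lemma cnt_split m (p q : pred nat) :
  (cnt m p = cnt m (fun x => p x && q x) + cnt m (fun x => p x && ~~ q x))%N.
Proof.
by rewrite /cnt -big_split; apply: eq_bigr => x _; case: (p x); case: (q x).
Qed.

(** * The uniform measure of clopen sets and of their increasing unions *)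

Section Weight.
Context {R : realType}.
Implicit Types (p q : pred nat).

(** The uniform measure of the clopen set of all [X] with [p (initial m X)]. *)
Definition weight m p : R := (cnt m p)%:R / 2 ^+ m.

Lemma weight_ge0 m p : 0 <= weight m p.
Proof. by rewrite divr_ge0 ?ler0n ?exprn_ge0. Qed.

Lemma le_weight m p q : (forall x, (x < 2 ^ m)%N -> p x -> q x) ->
  weight m p <= weight m q.
Proof.
by move=> pq; rewrite ler_pM2r ?invr_gt0 ?exprn_gt0 // ler_nat leq_cnt.
Qed.

Lemma eq_weight m p q : (forall x, (x < 2 ^ m)%N -> p x = q x) ->
  weight m p = weight m q.
Proof. by move=> pq; rewrite /weight (eq_cnt pq). Qed.

Lemma weight_mod m M p : (m <= M)%N ->
  weight M (fun x => p (x %% 2 ^ m)%N) = weight m p.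
Proof.
move=> mM; rewrite /weight cnt_mod // natrM natrX -{2}(subnK mM) exprD.
by field; rewrite !expf_neq0 ?pnatr_eq0.
Qed.

Lemma weight_cpre r m : (clen r <= m)%N -> weight m (cpre r) = 2 ^- clen r.
Proof.
move=> rm; rewrite /weight cnt_cpre // natrX -{2}(subnK rm) exprD.
by field; rewrite !expf_neq0 ?pnatr_eq0.
Qed.

Lemma weight_split m p q :
  weight m p = weight m (fun x => p x && q x) + weight m (fun x => p x && ~~ q x).
Proof. by rewrite /weight (cnt_split m p q) natrD mulrDl. Qed.

Lemma weightT m : weight m xpredT = 1.
Proof. by rewrite /weight cntT natrX divff // expf_neq0 ?pnatr_eq0. Qed.

Lemma weightC m p : weight m (fun x => ~~ p x) = 1 - weight m p.
Proof. by have := weight_split m xpredT p; rewrite weightT => ->;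
  rewrite addrC addKr. Qed.

Lemma weight_sum K m (p : nat -> pred nat) q :
  (forall x, (x < 2 ^ m)%N -> q x -> exists2 k, (k < K)%N & p k x) ->
  weight m q <= \sum_(0 <= k < K) weight m (p k).
Proof.
move=> qp; rewrite /weight -mulr_suml ler_pM2r ?invr_gt0 ?exprn_gt0 //.
rewrite -natr_sum ler_nat /cnt exchange_big /= !big_mkord.
apply: leq_sum => x _; case: (boolP (q x)) => // /qp[|k kK pk];
  first exact: ltn_ord.
by rewrite big_mkord (bigD1 (Ordinal kK)) //= pk.
Qed.

Lemma weight_disjoint K m (p : nat -> pred nat) q :
  (forall x k, (x < 2 ^ m)%N -> (k < K)%N -> p k x -> q x) ->
  (forall x i j, (x < 2 ^ m)%N -> p i x -> p j x -> i = j) ->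
  \sum_(0 <= k < K) weight m (p k) <= weight m q.
Proof.
move=> pq pdisj; rewrite /weight -mulr_suml ler_pM2r ?invr_gt0 ?exprn_gt0 //.
rewrite -natr_sum ler_nat /cnt exchange_big /= !big_mkord.
apply: leq_sum => x _; rewrite big_mkord.
have [/existsP[k pk]|/existsPn np] := boolP [exists k : 'I_K, p k x].
  rewrite (bigD1 k) //= pk (pq _ _ _ _ pk) //; rewrite big1 // => i ik.
  case: (boolP (p i x)) => // pi; case/eqP: ik; apply: val_inj.
  exact: pdisj pi pk.
by rewrite big1 // => k _; rewrite (negbTE (np k)).
Qed.

Local Notation L := (mu_outer (@lambda_cyl R)).

Lemma lambda_cyl_ge0 s : (0 <= @lambda_cyl R s)%E.
Proof. by rewrite lee_fin invr_ge0 exprn_ge0. Qed.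

Lemma lambda_cyl_small (d : R) : 0 < d -> exists s, (lambda_cyl R s <= d%:E)%E.
Proof.
move=> d0; exists (nseq (Num.bound d^-1) false).
rewrite lee_fin size_nseq -[leRHS]invrK lef_pV2 ?posrE ?exprn_gt0 ?invr_gt0 //.
by apply/ltW/upper_nthrootP.
Qed.

(** By compactness finitely many cylinders of a cover suffice; at a length exceeding all of theirs
    the claim is a union bound for counts. *)
Lemma weight_le_outer m p (A : set cantor) :
  (forall X, p (initial m X) -> A X) -> ((weight m p)%:E <= L A)%E.
Proof.
move=> pA; apply: le_ereal_inf_tmp => _ [c Ac <-].
have [K HK] : exists K, forall X, p (initial m X) -> exists2 k, (k < K)%N & pre (c k) X.
  apply: contrapT => /forallNP nK.
  (* Without a finite subcover, points missed by the first [n] cylinders accumulate at a point of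
     the clopen set, and the cylinder around it contains some of them. *)
  have [|K|X HX] := @cantor_compact (fun n => [set X | p (initial m X) /\
      forall k, (k < n)%N -> ~ pre (c k) X]).
  - by move=> n X [pX nX]; split=> // k kn; apply: nX; exact: ltnW.
  - have /existsNP[X /not_implyP[pX nX]] := nK K.
    by exists X; split=> // k kK pk; apply: nX; exists k.
  have pX : p (initial m X).
    by have [X' [pX' _] agree] := HX m; rewrite (initial_eq agree).
  have [k _ ck] := Ac X (pA X pX).
  have [X' [_ nX'] agree] := HX (maxn k.+1 (size (c k))).
  apply: (nX' k); first exact: leq_maxl.
  rewrite /pre -[RHS]ck; apply/eq_in_map => i; rewrite mem_iota => /andP[_ ik].
  by rewrite agree // (leq_trans ik) // leq_maxr.
pose M := maxn m (\max_(k < K) size (c k)).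
have szM k : (k < K)%N -> (size (c k) <= M)%N.
  move=> kK; apply: leq_trans (leq_maxr _ _).
  exact: (@leq_bigmax _ (fun k : 'I_K => size (c k)) (Ordinal kK)).
have mM : (m <= M)%N by exact: leq_maxl.
apply: le_trans (nneseries_lim_ge K _); last by move=> k _ _;
  exact: lambda_cyl_ge0.
rewrite sumEFin lee_fin -(weight_mod _ mM).
have -> : \sum_(0 <= k < K) (2%:R : R) ^- size (c k) =
          \sum_(0 <= k < K) weight M (cpre (code_str (c k))).
  by apply: eq_big_nat => k /andP[_ kK]; rewrite weight_cpre clen_code // szM.
apply: weight_sum => _ /initial_surj[X <-];
  rewrite initial_mod // => /HK[k kK ck].
by exists k => //; apply/cpreP => //; exact: szM.
Qed.

(* Increasing sequences of clopen sets, the [m]-th one depending on [m] bits. *)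
Definition clopen_seq (p : nat -> pred nat) :=
  forall m x, p m (x %% 2 ^ m)%N -> p m.+1 x.

Lemma clopen_seq_initial (p : nat -> pred nat) m M X : clopen_seq p ->
  (m <= M)%N ->
  p m (initial m X) -> p M (initial M X).
Proof.
move=> pS /subnK <-; elim: (M - m)%N => // k IH pm; apply: pS.
by rewrite initial_mod ?IH // addSn.
Qed.

Lemma le_weight_clopen (p : nat -> pred nat) m M : clopen_seq p -> (m <= M)%N ->
  weight m (p m) <= weight M (p M).
Proof.
move=> pS mM; rewrite -(weight_mod _ mM);
  apply: le_weight => _ /initial_surj[X <-].
by rewrite initial_mod //; exact: clopen_seq_initial.
Qed.

(** [A] is covered by the cylinders of those strings that enter [p] at the stage equal to their
    length. These are disjoint, and the ones of length at most [M] weigh exactly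
    [weight M (p M)]. *)
Lemma outer_le_weight (p : nat -> pred nat) (A : set cantor) (r : R) :
  clopen_seq p -> (forall X, A X -> exists m, p m (initial m X)) ->
  (forall m, weight m (p m) <= r) -> (L A <= r%:E)%E.
Proof.
move=> pS Ap pr.
(* The case [l == 0] admits the empty string, which has no earlier stage. *)
pose d l x := p l x && ((l == 0)%N || ~~ p l.-1 (x %% 2 ^ l.-1)%N).
pose b n := d (clen n) (n.+1 - 2 ^ clen n)%N.
apply: (@le_trans _ _ (\sum_(0 <= n <oo) (if b n then lambda_cyl R (dec n) else 0))%E).
  apply: mu_outer_le_cover; [exact: lambda_cyl_ge0|exact: lambda_cyl_small|].
  move=> X /Ap exm; case: (ex_minnP exm) => m pm minm.
  exists (code_str (mkseq X m)); last by rewrite code_strK /pre size_mkseq.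
  rewrite /b clen_code size_mkseq code_mkseq addKn /d pm /=.
  case: m pm minm => //= m pm minm; rewrite initial_mod //.
  by apply/negP => /minm; rewrite ltnn.
pose f n : R := if b n then 2 ^- clen n else 0.
rewrite (@eq_eseriesr _ _ (EFin \o f)); last first.
  by move=> n _; rewrite /= /f /lambda_cyl size_dec; case: ifP.
have f0 n : 0 <= f n by rewrite /f; case: ifP => // _;
  rewrite invr_ge0 exprn_ge0.
(* The codes below [2 ^ M.+1 - 1] are those of the strings of length at most [M]. *)
have sumf M : \sum_(0 <= n < (2 ^ M.+1).-1) f n = weight M (p M).
  elim: M => [|M IH].
    rewrite big_nat1 /f /b /d /weight /cnt big_nat1 expr0 /= divr1.
    by rewrite (_ : clen 0 = 0%N) //= andbT subnn invr1; case: (p _ _).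
  have sz : ((2 ^ M.+2).-1 = (2 ^ M.+1).-1 + 2 ^ M.+1)%N.
    have : (0 < 2 ^ M.+1)%N by rewrite expn_gt0.
    by rewrite [in LHS]expnS; lia.
  rewrite sz (big_cat_nat (n := (2 ^ M.+1).-1)) ?leq_addr //= IH.
  rewrite -{1}[(2 ^ M.+1).-1]add0n big_addn addKn.
  (* The new stage splits into what stage [M] already contained and what enters now; the latter is
     summed over the codes of length [M.+1]. *)
  rewrite [in RHS](weight_split _ _ (fun x => p M (x %% 2 ^ M)%N)).
  congr (_ + _).
    rewrite -(weight_mod (p M) (leqnSn M)); apply: eq_weight => x _.
    by apply/idP/andP => [pM|[]//]; split=> //; exact: pS.
  rewrite /weight /cnt natr_sum mulr_suml; apply: eq_big_nat => x /andP[_ xM].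
  have E : (x + (2 ^ M.+1).-1).+1 = (2 ^ M.+1 + x)%N.
    by have : (0 < 2 ^ M.+1)%N; [rewrite expn_gt0|lia].
  have C : clen (x + (2 ^ M.+1).-1) = M.+1.
    rewrite /clen E; apply: trunc_log_eq => //.
    by rewrite leq_addr [in X in (_ < X)%N]expnS mul2n -addnn ltn_add2l.
  rewrite /f /b C E addKn /d /=.
  by case: (p M.+1 x && _); rewrite /= ?mul0r ?mul1r.
apply: lime_le; first by apply: is_cvg_nneseries => n _ _; rewrite lee_fin.
apply: nearW => n;
  apply: (@le_trans _ _ (\sum_(0 <= k < (2 ^ n.+1).-1) (EFin \o f) k)%E).
  apply: lee_sum_nneg_natr => [k _ _|]; first by rewrite lee_fin.
  have : (n.+1 < 2 ^ n.+1)%N by exact: ltn_expl.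
  lia.
by rewrite sumEFin lee_fin sumf.
Qed.

(** The clopen set is regarded as a sequence that is empty before stage [m] and constant
    afterwards. *)
Lemma outer_clopen_le m p (A : set cantor) :
  (forall X, A X -> p (initial m X)) -> (L A <= (weight m p)%:E)%E.
Proof.
move=> Ap; apply: (@outer_le_weight (fun M x => (m <= M)%N && p (x %% 2 ^ m)%N)).
- move=> M x /andP[mM]; rewrite (leqW mM) modn_dvdm // dvdn_exp2l //.
- by move=> X /Ap pX; exists m; rewrite leqnn initial_mod.
move=> M; case: (leqP m M) => /= mM; first by rewrite weight_mod.
rewrite /weight /cnt big1 // mul0r; exact: weight_ge0.
Qed.

End Weight.

(** * Effectively open sets and the functional *)

Fixpoint pcode_tree (e : pcode) : GenTree.tree nat :=
  match e with
  | PZero => GenTree.Leaf 0%N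
  | PSucc => GenTree.Leaf 1%N
  | PId => GenTree.Leaf 2%N
  | PFst => GenTree.Leaf 3%N
  | PSnd => GenTree.Leaf 4%N
  | PPair f g => GenTree.Node 0 [:: pcode_tree f; pcode_tree g]
  | PComp f g => GenTree.Node 1 [:: pcode_tree f; pcode_tree g]
  | PPrec f g => GenTree.Node 2 [:: pcode_tree f; pcode_tree g]
  | PMu f => GenTree.Node 3 [:: pcode_tree f]
  end.

(** The default branch decodes [Leaf 4] and absorbs all malformed trees. *)
Fixpoint tree_pcode (t : GenTree.tree nat) : pcode :=
  match t with
  | GenTree.Leaf 0 => PZero
  | GenTree.Leaf 1 => PSucc
  | GenTree.Leaf 2 => PId
  | GenTree.Leaf 3 => PFst
  | GenTree.Node 0 [:: a; b] => PPair (tree_pcode a) (tree_pcode b)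
  | GenTree.Node 1 [:: a; b] => PComp (tree_pcode a) (tree_pcode b)
  | GenTree.Node 2 [:: a; b] => PPrec (tree_pcode a) (tree_pcode b)
  | GenTree.Node 3 [:: a] => PMu (tree_pcode a)
  | _ => PSnd
  end.

Lemma pcode_treeK : cancel pcode_tree tree_pcode.
Proof. by elim=> //= [f -> g ->|f -> g ->|f -> g ->|f ->]. Qed.

Lemma pcode_enumerable : exists E : nat -> pcode, forall e, exists n, E n = e.
Proof.
exists (fun n => if unpickle n is Some t then tree_pcode t else PZero) => e.
by exists (pickle (pcode_tree e)); rewrite pickleK pcode_treeK.
Qed.

(** * Stages of effectively open sets *)

Definition stage_open (f : nat -> pred nat) (m : nat) : pred nat :=
  fun x => has (fun r => f m r && cpre r x) (iota 0 m).

Definition increasing_stages (f : nat -> pred nat) := forall m r, f m r -> f m.+1 r.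

Lemma stage_mono f m M r : increasing_stages f -> (m <= M)%N -> f m r -> f M r.
Proof. by move=> fS /subnK <- fm; elim: (M - m)%N => // k IH; exact: fS. Qed.

(** A code below [m] belongs to a string shorter than [m], so stage [m] reads only [m] bits. *)
Lemma clopen_stage_open f : increasing_stages f -> clopen_seq (stage_open f).
Proof.
move=> fS m x /hasP[r]; rewrite mem_iota => /andP[_ rm] /andP[fr rx].
apply/hasP; exists r; first by rewrite mem_iota /= add0n ltnS ltnW.
by rewrite fS //= -(@cpre_mod _ m) // ltnW.
Qed.

Lemma stage_open_sound f m X : stage_open f m (initial m X) ->
  exists2 s, f m (code_str s) & pre s X.
Proof.
move=> /hasP[r]; rewrite mem_iota => /andP[_ rm] /andP[fr rx].
exists (dec r); first by rewrite decK.
apply/(@cpreP _ m); last by rewrite decK.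
by rewrite size_dec (leq_trans (clen_le r)) // ltnW.
Qed.

Lemma stage_open_complete f m X s : increasing_stages f ->
  f m (code_str s) -> pre s X -> exists M, stage_open f M (initial M X).
Proof.
move=> fS fm sX; exists (maxn m (code_str s).+1); apply/hasP.
exists (code_str s); first by rewrite mem_iota add0n leq_maxr.
rewrite (stage_mono fS (leq_maxl _ _) fm) /=; apply/cpreP => //.
apply: leq_trans (leq_maxr _ _); apply/leqW.
by rewrite -clen_code clen_le.
Qed.

Definition test_stage e k m r := (0 < run e m (cpair k r))%N.

Lemma increasing_test_stage e k : increasing_stages (test_stage e k).
Proof. by move=> m r; exact: run_monob. Qed.

Lemma eff_openP e k X :
  eff_open e k X <-> exists m, stage_open (test_stage e k) m (initial m X).
Proof.
split=> [[s [/haltsP[m hm] sX]]|[m /stage_open_sound[s hm sX]]].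
  by apply: stage_open_complete sX; [exact: increasing_test_stage|exact: hm].
by exists s; split=> //; apply/haltsP; exists m.
Qed.

(** The parameter [q] lets one construction serve for outputs extending a string, outputs leaving
    it, and outputs of at least a given length. *)
Definition out_stage e (q : pred nat) m r :=
  has (fun t => q t && (0 < run e m (cpair r t))%N) (iota 0 m).

Lemma increasing_out_stage e q : increasing_stages (out_stage e q).
Proof.
move=> m r /hasP[t]; rewrite mem_iota => /andP[_ tm] /andP[qt rt].
apply/hasP; exists t; first by rewrite mem_iota add0n /= ltnS ltnW.
by rewrite qt (run_monob (leqnSn m) rt).
Qed.

Lemma computableb_stage_open (f : nat -> nat -> nat -> bool) N M X :
  computable N -> computable M -> computable X ->
  computableb (fun z => f (unpair1 z) (unpair1 (unpair2 z)) (unpair2 (unpair2 z))) ->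
  computableb (fun z => stage_open (f (N z)) (M z) (X z)).
Proof.
move=> HN HM HX Hf; rewrite /stage_open; apply: computableb_has => //.
apply: computableb_and; last by apply: computableb_cpre; computable_tac.
apply: (@eq_computable (fun z => f (N (unpair1 z)) (unpair1 (cpair (M (unpair1 z))
  (unpair2 z))) (unpair2 (cpair (M (unpair1 z)) (unpair2 z))))).
  by move=> z; rewrite unpair1K unpair2K.
apply: (computable_comp2 (h := fun n v => f n (unpair1 v) (unpair2 v)) Hf);
  computable_tac.
Qed.

Lemma pre_prefix s s' X : pre s X -> pre s' X -> (size s <= size s')%N ->
  prefix s s'.
Proof.
rewrite /pre prefixE => <- <-; rewrite !size_mkseq => ss'.
by rewrite -map_take take_iota (minn_idPl ss').
Qed.

Lemma prefix_pre s s' X : prefix s s' -> pre s' X -> pre s X.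
Proof.
rewrite /pre prefixE => /eqP E E'; have ss' : (size s <= size s')%N.
  by rewrite -E size_take_min geq_minr.
by rewrite -[RHS]E -[in RHS]E' -map_take take_iota (minn_idPl ss').
Qed.

Lemma prefix_comparable (s s' t : str) : prefix s t -> prefix s' t ->
  prefix s s' || prefix s' s.
Proof.
move=> st s't; have pt (u : str) : prefix u t -> pre u (nth false t).
  by move/prefix_pre; apply; exact: mkseq_nth_size.
case: (leqP (size s) (size s')) => [|/ltnW] le.
  by rewrite (pre_prefix (pt _ st) (pt _ s't) le).
by rewrite (pre_prefix (pt _ s't) (pt _ st) le) orbT.
Qed.

(** * Preimages of cylinders under the functional *)

Section Functional.
Context {R : realType}.
Variables (Phi : functional) (e0 : pcode).
Hypothesis PhiP : forall s t, Phi s t <-> halts e0 (cpair (code_str s) (code_str t)).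
Hypothesis Phi_consistent : forall s t s' t', Phi s t -> Phi s' t' ->
  prefix s s' -> prefix t t' || prefix t' t.
Hypothesis Phi_total : almost_total R Phi.

Local Notation L := (mu_outer (@lambda_cyl R)).
Local Notation out q := (stage_open (out_stage e0 q)).

Lemma out_sound (q : pred nat) m X : out q m (initial m X) ->
  exists s t, [/\ Phi s t, pre s X & q (code_str t)].
Proof.
move=> /stage_open_sound[s /hasP[t _ /andP[qt st]] sX].
exists s, (dec t); split=> //; rewrite ?decK //; apply/PhiP/haltsP.
by exists m; rewrite decK.
Qed.

Lemma out_complete (q : pred nat) s t X : Phi s t -> pre s X ->
  q (code_str t) ->
  exists m, out q m (initial m X).
Proof.
move=> /PhiP/haltsP[m st] sX qt.
apply: (stage_open_complete (m := maxn m (code_str t).+1)) sX.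
  exact: increasing_out_stage.
apply/hasP; exists (code_str t); first by rewrite mem_iota add0n leq_maxr.
by rewrite qt (run_monob _ st) ?leq_maxl.
Qed.

Lemma out_comparable X s t s' t' : Phi s t -> Phi s' t' -> pre s X ->
  pre s' X ->
  prefix t t' || prefix t' t.
Proof.
move=> st st' sX sX'; case: (leqP (size s) (size s')) => [|/ltnW] le.
  exact: Phi_consistent st st' (pre_prefix sX sX' le).
by rewrite orbC; exact: Phi_consistent st' st (pre_prefix sX' sX le).
Qed.

Lemma out_ext_comparable X s s' : out_ext Phi X s -> out_ext Phi X s' ->
  prefix s s' || prefix s' s.
Proof.
case=> [->|[r [t [rt [rX st]]]]]; first by rewrite prefix0s.
case=> [->|[r' [t' [rt' [rX' st']]]]]; first by rewrite prefix0s orbT.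
case/orP: (out_comparable rt rt' rX rX') => tt'.
  exact: prefix_comparable (prefix_trans st tt') st'.
exact: prefix_comparable st (prefix_trans st' tt').
Qed.

(** The code [0] is that of the empty string, which every output extends even if nothing has been
    enumerated. *)
Definition out_ext_stage (w m : nat) : pred nat :=
  fun x => (w == 0)%N || out (cprefix w) m x.

(** An output that is long enough and does not extend the string is incompatible with it. On the
    domain this effectively open set is the complement of the preimage, so it approximates the
    preimage from outside. *)
Definition out_anti_stage (w m : nat) : pred nat :=
  out (fun t => (clen w <= clen t)%N && ~~ cprefix w t) m.

Lemma clopen_out_ext_stage w : clopen_seq (out_ext_stage w).
Proof.
move=> m x; rewrite /out_ext_stage; case: eqP => //= _.
exact/clopen_stage_open/increasing_out_stage.
Qed.

Lemma clopen_out_anti_stage w : clopen_seq (out_anti_stage w).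
Proof. exact/clopen_stage_open/increasing_out_stage. Qed.

Lemma out_extP X s :
  out_ext Phi X s <-> exists m, out_ext_stage (code_str s) m (initial m X).
Proof.
rewrite /out_ext_stage; split.
  case=> [->|[r [t [rt [rX st]]]]]; first by exists 0%N.
  have [|m H] := out_complete (q := cprefix (code_str s)) rt rX.
    by rewrite cprefixE.
  by exists m; rewrite H orbT.
case=> m /orP[/eqP s0|/out_sound[r [t [rt rX st]]]].
  by left; apply: code_str_inj; rewrite s0.
by right; exists r, t; rewrite -cprefixE.
Qed.

Lemma out_anti_sound X s m : out_anti_stage (code_str s) m (initial m X) ->
  ~ out_ext Phi X s.
Proof.
move=> /out_sound[r [t [rt rX /andP[]]]]; rewrite !clen_code cprefixE => st nst.
case=> [s0|[r' [t' [rt' [rX' st']]]]]; first by rewrite s0 prefix0s in nst.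
have : prefix s t || prefix t s.
  case/orP: (out_comparable rt rt' rX rX') => tt'.
    exact: prefix_comparable st' tt'.
  by rewrite (prefix_trans st' tt').
rewrite (negbTE nst) /= prefixE take_oversize // => /eqP ts.
by rewrite ts prefix_refl in nst.
Qed.

Lemma dom_out X s : in_dom Phi X ->
  out_ext Phi X s \/ exists m, out_anti_stage (code_str s) m (initial m X).
Proof.
move=> /(_ (size s)) [r [t [rt [rX st]]]].
case: (boolP (prefix s t)) => [pst|npst]; first by left; right; exists r, t.
right; apply: (out_complete rt rX).
by rewrite !clen_code st cprefixE.
Qed.

Lemma lambda_Phi_ge0 s : (0 <= lambda_Phi R Phi s)%E.
Proof. by apply: mu_outer_ge0 => u; exact: lambda_cyl_ge0. Qed.

Lemma lambda_Phi_le s (r : R) :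
  (forall m, weight m (out_ext_stage (code_str s) m) <= r) ->
  (lambda_Phi R Phi s <= r%:E)%E.
Proof.
by move=> H; apply: outer_le_weight H;
  [exact: clopen_out_ext_stage|move=> X /out_extP].
Qed.

(** Otherwise the pairwise incomparable strings [1...10] would have disjoint preimages of measure
    greater than [d], and more than [1 / d] of them exceed total measure [1]. *)
Lemma lambda_Phi_small (d : R) : 0 < d ->
  exists s, (lambda_Phi R Phi s <= d%:E)%E.
Proof.
move=> d0; apply: contrapT => /forallNP big.
pose s k := rcons (nseq k true) false.
have /choice[m Hm] k : exists m, d < weight m (out_ext_stage (code_str (s k)) m) :> R.
  apply: contrapT => /forallNP Hm; apply: (big (s k));
    apply: lambda_Phi_le => m.
  by rewrite leNgt; apply/negP/Hm.
pose K := Num.bound d^-1.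
pose M := \max_(k < K) m k.
have : \sum_(0 <= k < K) weight M (out_ext_stage (code_str (s k)) M) <= weight M xpredT :> R.
  apply: weight_disjoint => // _ i j /initial_surj[X <-] Hi Hj.
  have {Hi} Hi : out_ext Phi X (s i) by apply/out_extP; exists M.
  have {Hj} Hj : out_ext Phi X (s j) by apply/out_extP; exists M.
  have sP a b : prefix (s a) (s b) -> (a <= b)%N -> a = b.
    move=> /prefixP[u E]; rewrite leq_eqVlt => /orP[/eqP //|ab].
    have := congr1 (fun v => nth false v a) E.
    rewrite /s nth_cat nth_rcons size_nseq ab nth_nseq ab.
    by rewrite nth_rcons size_rcons size_nseq ltnSn ltnn eqxx.
  have sP' a b : prefix (s a) (s b) -> a = b.
    move=> pab; apply: sP => //; have := size_prefix pab.
    by rewrite !size_rcons !size_nseq ltnS.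
  by case/orP: (out_ext_comparable Hi Hj) => /sP'.
rewrite weightT; apply/negP; rewrite -ltNge.
apply: (@lt_le_trans _ _ (\sum_(0 <= k < K) d)).
  rewrite sumr_const_nat subn0 -mulr_natl -ltr_pdivrMr // div1r.
  by have := archi_boundP (ltW (_ : 0 < d^-1)); apply; rewrite invr_gt0.
apply: ler_sum_nat => k /andP[_ kK]; apply: le_trans (ltW (Hm k)) _.
apply: le_weight_clopen; first exact: clopen_out_ext_stage.
exact: (@leq_bigmax _ (fun k : 'I_K => m k) (Ordinal kK)).
Qed.

(** * Density of a test in the preimage of a string *)

Definition in_test e k w m : pred nat :=
  fun x => stage_open (test_stage e k) m x && out_ext_stage w m x.

(* Observed at stage [m]: the [k]-th component of the test [e] covers a fraction
   at least [2 ^- j] of the preimage of the string coded by [w]. *)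
Definition dense e j k w m :=
  (cnt m (fun x => ~~ out_anti_stage w m x) < 2 ^ j * cnt m (in_test e k w m))%N.

Lemma clopen_in_test e k w : clopen_seq (in_test e k w).
Proof.
move=> m x /andP[H1 H2]; apply/andP; split.
  exact: (clopen_stage_open (@increasing_test_stage e k)).
exact: clopen_out_ext_stage.
Qed.

Lemma weight_out_ext_le s m :
  (lambda_Phi R Phi s <= (weight m (fun x => ~~ out_anti_stage (code_str s) m x))%:E)%E.
Proof.
by apply: outer_clopen_le => X Xs; apply/negP => /out_anti_sound.
Qed.

Lemma dense_lambda_Phi e j k s m M : dense e j k (code_str s) m -> (m <= M)%N ->
  (lambda_Phi R Phi s <= (2 ^+ j * weight M (in_test e k (code_str s) M))%:E)%E.
Proof.
move=> H mM; apply: le_trans (weight_out_ext_le s m) _; rewrite lee_fin.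
apply: (@le_trans _ _ (2 ^+ j * weight m (in_test e k (code_str s) m))).
  rewrite /weight mulrA ler_pM2r ?invr_gt0 ?exprn_gt0 //.
  by rewrite -natrX -natrM ler_nat ltnW.
by rewrite ler_pM2l ?exprn_gt0 // le_weight_clopen //; exact: clopen_in_test.
Qed.

(** Suppose some stage of the intersection has weight [a] with [2 ^ j * a] above [lambda_Phi] of
    [s]. Absence of density keeps the incompatible part below [1 - 2 ^ j * a], so together with the
    preimage it has measure less than [1], against almost totality. *)
Lemma not_dense_outer e j k s : (forall m, ~~ dense e j k (code_str s) m) ->
  (L (eff_open e k `&` [set X | out_ext Phi X s]) <=
   (2 ^- j)%:E * lambda_Phi R Phi s)%E.
Proof.
move=> nd.
have lf : lambda_Phi R Phi s \is a fin_num.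
  rewrite ge0_fin_numE ?lambda_Phi_ge0 //.
  by apply: le_lt_trans (weight_out_ext_le s 0) _; rewrite ltry.
rewrite -(fineK lf) -EFinM; set l := fine _.
apply: (outer_le_weight (p := in_test e k (code_str s))).
- exact: clopen_in_test.
- move=> X [/eff_openP[m1 H1] /out_extP[m2 H2]]; exists (maxn m1 m2);
  apply/andP; split.
    apply: clopen_seq_initial H1; last exact: leq_maxl.
    exact/clopen_stage_open/increasing_test_stage.
  apply: clopen_seq_initial H2; last exact: leq_maxr.
  exact: clopen_out_ext_stage.
move=> m; rewrite leNgt; apply/negP; set a := weight _ _ => lta.
have anti_le M : weight M (out_anti_stage (code_str s) M) <= 1 - 2 ^+ j * a.
  (* Stages before [m] are contained in later ones, where the weight [a] has already been
     reached. *)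
  suff H N : (m <= N)%N -> weight N (out_anti_stage (code_str s) N) <= 1 - 2 ^+ j * a.
    apply: le_trans (H _ (leq_maxl m M));
      apply: le_weight_clopen (leq_maxr _ _).
    exact: clopen_out_anti_stage.
  move=> mN; suff : 2 ^+ j * a <= 1 - weight N (out_anti_stage (code_str s) N) by lra.
  rewrite -weightC;
    apply: (@le_trans _ _ (2 ^+ j * weight N (in_test e k (code_str s) N))).
    by rewrite ler_pM2l ?exprn_gt0 // le_weight_clopen //;
      exact: clopen_in_test.
  rewrite /weight mulrA ler_pM2r ?invr_gt0 ?exprn_gt0 //.
  by rewrite -natrX -natrM ler_nat leqNgt nd.
pose N := [set X | exists m, out_anti_stage (code_str s) m (initial m X)].
have LN : (L N <= (1 - 2 ^+ j * a)%:E)%E.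
  by apply: outer_le_weight anti_le; [exact: clopen_out_anti_stage|].
have : (1 <= L N + lambda_Phi R Phi s)%E.
  rewrite -Phi_total; apply: le_trans (mu_outerU _ _ lambda_cyl_ge0).
  by apply: mu_outer_mono => X /(dom_out s)[|]; [right|left].
apply/negP; rewrite -ltNge; apply: le_lt_trans (leeD LN (lexx _)) _.
rewrite -(fineK lf) -EFinD lte_fin -/l.
suff : l < 2 ^+ j * a by lra.
by rewrite -ltr_pdivrMl ?exprn_gt0.
Qed.

(** The prefix-minimal dense strings already cover. Their preimages are disjoint, and each has
    measure at most [2 ^ j] times that of the part of the test inside it. *)
Lemma outer_dense e j k :
  (mu_outer (lambda_Phi R Phi)
     [set Y | exists2 s, (exists m, dense e j k (code_str s) m) & pre s Y] <=
   (2 ^+ j)%:E * L (eff_open e k))%E.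
Proof.
pose d w := exists m, dense e j k w m.
pose b w := `[< d w /\ forall s, prefix s (dec w) -> d (code_str s) -> s = dec w >].
apply: (@le_trans _ _ (\sum_(0 <= w <oo) (if b w then lambda_Phi R Phi (dec w) else 0))%E).
  apply: mu_outer_le_cover; [exact: lambda_Phi_ge0|exact: lambda_Phi_small|].
  move=> Y [s ds sY].
  have ex : exists n, `[< d (code_str (mkseq Y n)) >].
    by exists (size s); apply/asboolP; rewrite sY.
  case: (ex_minnP ex) => n /asboolP dn minn.
  exists (code_str (mkseq Y n)); last by rewrite code_strK /pre size_mkseq.
  apply/asboolP; split=> // u; rewrite code_strK => pu du.
  have uY : pre u Y by apply: prefix_pre pu _; rewrite /pre size_mkseq.
  have := size_prefix pu; rewrite size_mkseq => un.
  have nu : (n <= size u)%N by apply: minn; apply/asboolP; rewrite uY.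
  by rewrite -uY; congr mkseq; apply/eqP; rewrite eqn_leq un.
apply: lime_le.
  by apply: is_cvg_nneseries => n _ _; case: ifP => // _; exact: lambda_Phi_ge0.
apply: nearW => K.
have /choice[m Hm] w : exists m, b w -> dense e j k w m.
  case: (boolP (b w)) => [/asboolP[[m dm] _]|_]; last by exists 0%N.
  by exists m.
(* A partial sum involves finitely many strings, whose density is witnessed by stages up to [M]. *)
pose M := \max_(w < K) m w.
apply: (@le_trans _ _ (\sum_(0 <= w < K)
    (2 ^+ j * weight M (fun x => b w && in_test e k w M x))%:E)%E).
  rewrite !big_nat; apply: lee_sum => w /andP[_ wK].
  case: (boolP (b w)) => [bw|_]; last first.
    by rewrite lee_fin mulr_ge0 ?weight_ge0 ?exprn_ge0.
  have := @dense_lambda_Phi e j k (dec w) (m w) M; rewrite decK; apply;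
    first exact: Hm.
  exact: (@leq_bigmax _ (fun w : 'I_K => m w) (Ordinal wK)).
rewrite sumEFin -mulr_sumr EFinM; apply: lee_wpmul2l.
  by rewrite lee_fin exprn_ge0.
apply: (@le_trans _ _ (weight M (stage_open (test_stage e k) M))%:E).
  rewrite lee_fin; apply: weight_disjoint.
    by move=> x w _ _ /andP[_ /andP[]].
  move=> _ w w' /initial_surj[X <-].
  move=> /andP[/asboolP[dw minw] /andP[_ Xw]] /andP[/asboolP[dw' minw'] /andP[_ Xw']].
  have {}Xw : out_ext Phi X (dec w) by apply/out_extP; exists M; rewrite decK.
  have {}Xw' : out_ext Phi X (dec w') by apply/out_extP; exists M; rewrite decK.
  rewrite -(decK w) -(decK w'); congr code_str.
  case/orP: (out_ext_comparable Xw Xw') => pww'; last symmetry.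
    by apply: minw' pww' _; rewrite decK.
  by apply: minw pww' _; rewrite decK.
by apply: weight_le_outer => X HX; apply/eff_openP; exists M.
Qed.

(** * Decidability of density at a given stage *)

Lemma computableb_test_stage e K N M : computable K -> computable N ->
  computable M -> computableb (fun z => test_stage e (K z) (M z) (N z)).
Proof.
move=> HK HN HM; rewrite /test_stage; computable_tac.
by apply: computable_run; computable_tac.
Qed.

Lemma computableb_out (q : nat -> pred nat) W M X :
  computableb (fun z => q (unpair1 z) (unpair2 z)) ->
  computable W -> computable M -> computable X ->
  computableb (fun z => out (q (W z)) (M z) (X z)).
Proof.
move=> Hq HW HM HX.
apply: (@computableb_stage_open (fun w => out_stage e0 (q w))) => //.
rewrite /out_stage; apply: computableb_has; first by computable_tac.
apply: computableb_and.
  by apply: (computable_comp2 (h := fun w t => nat_of_bool (q w t)) Hq);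
    computable_tac.
by computable_tac; apply: computable_run; computable_tac.
Qed.

Lemma computableb_dense e j :
  computableb (fun z => dense e j (unpair1 (unpair1 z)) (unpair2 (unpair1 z)) (unpair2 z)).
Proof.
rewrite /dense /cnt; computable_tac; apply: computable_sum; computable_tac.
  apply: (@computableb_out (fun w t => (clen w <= clen t)%N && ~~ cprefix w t));
    computable_tac; try by apply: computable_clen; computable_tac.
  by apply: computableb_cprefix; computable_tac.
rewrite /in_test /out_ext_stage; computable_tac.
  apply: (@computableb_stage_open (fun k => test_stage e k)); computable_tac.
  by apply: computableb_test_stage; computable_tac.
apply: computableb_out; computable_tac.
by apply: computableb_cprefix; computable_tac.
Qed.

(** * Consequences of weak 2-randomness *)

Definition is_test (mu : str -> \bar R) e :=
  (fun i => mu_outer mu (eff_open e i)) @ \oo --> 0%E.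

(** The dense strings generate a test for [lambda_Phi]; the component that [Y] avoids gives a single
    [k] valid for all prefixes of [Y]. *)
Lemma W2R_not_dense Y e j : W2R (lambda_Phi R Phi) Y ->
  is_test (@lambda_cyl R) e -> exists k, forall n,
  (L (eff_open e k `&` [set X | out_ext Phi X (mkseq Y n)]) <=
   (2 ^- j)%:E * lambda_Phi R Phi (mkseq Y n))%E.
Proof.
move=> YW2R Le0.
have [e' He'] := computable_sigma1
  (P := fun z m => dense e j (unpair1 z) (unpair2 z) m) (computableb_dense e j).
have openE k : eff_open e' k =
    [set Z | exists2 s, (exists m, dense e j k (code_str s) m) & pre s Z].
  apply/seteqP; split=> Z.
    by move=> [s [/He'[m]]]; rewrite unpair1K unpair2K => H sZ; exists s => //;
      exists m.
  move=> [s [m H] sZ]; exists s; split=> //; apply/He'; exists m.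
  by rewrite unpair1K unpair2K.
have Le'0 : is_test (lambda_Phi R Phi) e'.
  apply: (@squeeze_cvge _ _ _ _ (fun=> 0%E) _ (fun i => (2 ^+ j)%:E * L (eff_open e i))%E).
  - apply: nearW => i; rewrite openE outer_dense andbT.
    by apply: mu_outer_ge0; exact: lambda_Phi_ge0.
  - exact: cvg_cst.
  - by rewrite -[0%E](mule0 (2 ^+ j)%:E); exact: cvgeZl.
have /existsNP[k nk] := YW2R e' Le'0; exists k => n.
apply: not_dense_outer => m; apply/negP => H; apply: nk; rewrite openE.
by exists (mkseq Y n); [exists m|rewrite /pre size_mkseq].
Qed.

(** Were the cylinder null, the sequence constantly equal to it would be a test capturing [Y]. *)
Lemma W2R_lambda_Phi_gt0 Y n : W2R (lambda_Phi R Phi) Y ->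
  (0 < lambda_Phi R Phi (mkseq Y n))%E.
Proof.
move=> YW2R; rewrite lt0e lambda_Phi_ge0 andbT; apply/eqP => l0.
pose c := code_str (mkseq Y n).
have [|e He] := computable_sigma1 (P := fun z _ => unpair2 z == c).
  by computable_tac.
have openE k : eff_open e k `<=` cyl (mkseq Y n).
  move=> Z [s [/He[_]]]; rewrite unpair2K => /eqP /code_str_inj ->; exact.
apply: (YW2R e) => [|k].
  rewrite (_ : (fun _ => _) = fun=> 0%E); first exact: cvg_cst.
  apply/funext => i; apply/eqP; rewrite eq_le mu_outer_ge0 ?andbT;
    last exact: lambda_Phi_ge0.
  apply: le_trans (mu_outer_le_cover (b := eq_op^~ c) _ _ _) _.
  - exact: lambda_Phi_ge0.
  - exact: lambda_Phi_small.
  - by move=> Z /openE; exists c => //; rewrite code_strK.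
  rewrite eseries0 // => w _ _; case: eqP => // ->.
  by rewrite code_strK.
exists (mkseq Y n); split; last by rewrite /pre size_mkseq.
by apply/He; exists 0%N; rewrite unpair2K.
Qed.

(** For fixed [n], the inputs not seen by stage [i] to have output of length at least [n] form a
    clopen set. Its measure tends to [0] by almost totality, so these sets are a test. *)
Lemma W2R_in_dom X : W2R (@lambda_cyl R) X -> in_dom Phi X.
Proof.
move=> XW2R n; apply: contrapT => nX.
pose q : pred nat := fun t => (n <= clen t)%N.
(* The complement of stage [i] is given by its strings of length [i]; the search variable [w] is a
   dummy. *)
pose P z (w : nat) := (clen (unpair2 z) == unpair1 z) &&
  ~~ out q (unpair1 z) ((unpair2 z).+1 - 2 ^ clen (unpair2 z))%N.
have [|e He] := computable_sigma1 (P := P).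
  have Hc : computable (fun z => clen (unpair2 (unpair1 z))).
    by apply: computable_clen; computable_tac.
  rewrite /P; computable_tac.
  apply: (@computableb_out (fun=> q) (fun=> 0%N)); computable_tac.
  by rewrite /q; computable_tac; apply: computable_clen; computable_tac.
have openE i : eff_open e i = [set Z | ~~ out q i (initial i Z)].
  apply/seteqP; split=> Z /=.
    move=> [s [/He[w]]]; rewrite /P unpair1K unpair2K clen_code.
    move=> /andP[/eqP <-] + sZ; have := code_mkseq (size s) Z.
    by rewrite [mkseq _ _]sZ => ->; rewrite addKn.
  move=> H; exists (mkseq Z i); split; last by rewrite /pre size_mkseq.
  apply/He; exists 0%N.
  by rewrite /P unpair1K unpair2K clen_code size_mkseq eqxx code_mkseq addKn.
apply: (XW2R e) => [|i]; last first.
  rewrite openE /=; apply/negP => /out_sound[s [t [st sX]]].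
  by rewrite /q clen_code => nt; apply: nX; exists s, t.
have qS : clopen_seq (stage_open (out_stage e0 q)).
  exact/clopen_stage_open/increasing_out_stage.
apply: (@squeeze_cvge _ _ _ _ (fun=> 0%E) _ (fun i => (1 - weight i (out q i) : R)%:E)).
- apply: nearW => i; rewrite mu_outer_ge0 /=; last exact: lambda_cyl_ge0.
  by rewrite -weightC; apply: outer_clopen_le => Z; rewrite openE.
- exact: cvg_cst.
apply: cvg_EFin; first exact: nearW.
apply/cvgrPdist_le => d d0.
have [m Hm] : exists m, 1 - d < weight m (out q m) :> R.
  apply: contrapT => /forallNP Hm.
  have : (L (in_dom Phi) <= (1 - d)%:E)%E.
    apply: (outer_le_weight qS) => [Z /(_ n)[s [t [st [sZ nt]]]]|m].
      by apply: (out_complete st sZ); rewrite /q clen_code.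
    by rewrite leNgt; apply/negP/Hm.
  by rewrite Phi_total lee_fin; lra.
exists m => // i /= mi; have := le_weight_clopen qS mi : _ <= _ :> R.
have : weight i (out q i) <= weight i xpredT :> R by exact: le_weight.
by rewrite weightT sub0r normrN => w1 wm; rewrite ger0_norm; lra.
Qed.

(** * Construction of a random preimage *)

Lemma W2R_preimage Y : W2R (lambda_Phi R Phi) Y ->
  exists X, [/\ W2R (@lambda_cyl R) X, in_dom Phi X & out_is Phi X Y].
Proof.
move=> YW2R; have [E Esurj] := pcode_enumerable.
(* [U j] is a component of the test with code [E j], or empty if [E j] gives no test. The fractions
   [2 ^- j.+2] add up to at most [1 / 2]. *)
have /choice[U HU] j : exists U : set cantor,
    [/\ forall X, U X -> exists s, pre s X /\ cyl s `<=` U,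
        forall n, (L (U `&` [set X | out_ext Phi X (mkseq Y n)]) <=
                   (2 ^- j.+2)%:E * lambda_Phi R Phi (mkseq Y n))%E &
        is_test (@lambda_cyl R) (E j) -> exists k, U = eff_open (E j) k].
  case: (pselect (is_test (@lambda_cyl R) (E j))) => [test|nt]; last first.
    exists set0; split=> // n; rewrite set0I.
    apply: (@le_trans _ _ 0%E).
      have := @outer_clopen_le R 0 xpred0 set0;
        rewrite /weight /cnt big1 // mul0r; exact.
    by rewrite mule_ge0 ?lambda_Phi_ge0 // lee_fin invr_ge0 exprn_ge0.
  have [k Hk] := W2R_not_dense j.+2 YW2R test.
  exists (eff_open (E j) k); split=> //; last by exists k.
  by move=> X [s [hs sX]]; exists s; split=> // Z sZ; exists s.
pose pre_n n := [set X | out_ext Phi X (mkseq Y n)].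
pose C n := [set X | pre_n n X /\ forall j, (j < n)%N -> ~ U j X].
have C0 n : C n !=set0.
  have l0 := W2R_lambda_Phi_gt0 n YW2R; set l := lambda_Phi R Phi _ in l0.
  have lf : l \is a fin_num.
    rewrite ge0_fin_numE ?ltW //.
    by apply: le_lt_trans (weight_out_ext_le _ 0) _; rewrite ltry.
  apply/set0P/negP => /eqP Cn0.
  (* The factor is the sum of [2 ^- j.+2] over [j < N]. *)
  have cover N : (L ([set X | exists2 j, (j < N)%N & U j X] `&` pre_n n) <=
      (2 ^- 1 - 2 ^- N.+1)%:E * l)%E.
    elim: N => [|N IH].
      rewrite subrr mul0e.
      have := @outer_clopen_le R 0 xpred0; rewrite /weight /cnt big1 // mul0r;
        apply.
      by move=> X [[]].
    apply: (@le_trans _ _ (L (([set X | exists2 j, (j < N)%N & U j X] `&` pre_n n) `|`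
        (U N `&` pre_n n)))).
      apply: mu_outer_mono => X [[j]];
        rewrite ltnS leq_eqVlt => /orP[/eqP ->|jN] Uj Xn.
        by right.
      by left; split=> //; exists j.
    apply: le_trans (mu_outerU _ _ lambda_cyl_ge0) _.
    have [_ /(_ n) HN _] := HU N; apply: le_trans (leeD IH HN) _.
    rewrite -/l -(fineK lf) -!EFinM -EFinD lee_fin -mulrDl.
    apply: ler_wpM2r; first by rewrite fine_ge0 // ltW.
    have -> : (2 ^- N.+1 : R) = 2 * 2 ^- N.+2.
      by rewrite [2 ^+ N.+2]exprS invfM mulrA divff ?mul1r.
    lra.
  have : (l <= (2 ^- 1 - 2 ^- n.+1)%:E * l)%E.
    apply: le_trans (cover n); apply: mu_outer_mono => X Xn; split=> //.
    apply: contrapT => nX; have : C n X.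
      by split=> // j jn Uj; apply: nX; exists j.
    by rewrite Cn0.
  apply/negP; rewrite -ltNge -(fineK lf) -EFinM lte_fin.
  rewrite -[ltRHS]mul1r ltr_pM2r; last by rewrite fine_gt0 // l0 ltey_eq lf.
  have : 0 < 2 ^- n.+1 :> R by rewrite invr_gt0 exprn_gt0.
  by rewrite expr1; lra.
have CS n : C n.+1 `<=` C n.
  move=> X [Xn HX]; split=> [|j jn]; last by apply: HX; exact: ltnW.
  case: Xn => [/(congr1 size)|[r [t [rt [rX nt]]]]];
    first by rewrite size_mkseq.
  right; exists r, t; split=> //; split=> //; apply: prefix_trans nt.
  by rewrite mkseqS prefix_rcons.
have [X HX] := cantor_compact CS C0; exists X.
have agree_pre s n X' : (forall i, (i < n)%N -> X i = X' i) -> (size s <= n)%N ->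
    pre s X -> pre s X'.
  move=> agree sn; rewrite /pre => {2}<-; apply/eq_in_map => i.
  by rewrite mem_iota => /andP[_ si]; rewrite agree // (leq_trans si).
have XW2R : W2R (@lambda_cyl R) X.
  move=> e; have [j <-] := Esurj e => test allX.
  have [Uopen _ /(_ test)[k Uk]] := HU j.
  (* As [U j] is open, it would also contain the nearby points of the sets [C n], which avoid it for
     [n] above [j]. *)
  have [s [sX sU]] : exists s, pre s X /\ cyl s `<=` U j by apply: Uopen;
    rewrite Uk.
  have [X' [_ HX'] agree] := HX (maxn j.+1 (size s)).
  apply: (HX' j); first exact: leq_maxl.
  by apply: sU; apply: agree_pre agree _ sX; exact: leq_maxr.
split=> //; first exact: W2R_in_dom.
(* The output [t] is compared with that of a nearby point which also reads [s] and whose output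
   extends a prefix of [Y] at least as long as [t]. *)
move=> s t st sX; have [X' [Xn _] agree] := HX (maxn (size s) (size t)).
have sX' : pre s X' by apply: agree_pre agree _ sX; exact: leq_maxl.
have : prefix t (mkseq Y (maxn (size s) (size t))).
  case: Xn => [n0|[r [u [ru [rX' nu]]]]].
    have : (size t <= 0)%N.
      by rewrite -[0%N]/(size (@nil bool)) -n0 size_mkseq leq_maxr.
    by rewrite leqn0 => /nilP ->; rewrite prefix0s.
  have : prefix t (mkseq Y (maxn (size s) (size t))) ||
         prefix (mkseq Y (maxn (size s) (size t))) t.
    case/orP: (out_comparable st ru sX' rX') => tu.
      exact: prefix_comparable tu nu.
    by rewrite (prefix_trans nu tu) orbT.
  case/orP => // nt; have := size_prefix nt; rewrite size_mkseq => le.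
  move: nt; rewrite prefixE size_mkseq => /eqP <-.
  by rewrite take_oversize ?leq_maxr ?prefix_refl.
by move/prefix_pre; apply; rewrite /pre size_mkseq.
Qed.

End Functional.

Theorem theorem6p18 (R : realType) (Phi : functional) (Y : cantor) :
  turing_functional Phi ->
  almost_total R Phi ->
  W2R (lambda_Phi R Phi) Y ->
  exists X : cantor, W2R (@lambda_cyl R) X /\ in_dom Phi X /\ out_is Phi X Y.
Proof.
move=> [[e He] cons] total YW2R.
have PhiP s t : Phi s t <-> halts e (cpair (code_str s) (code_str t)).
  split=> [st|/He[s' [t' [/cpair_inj[/code_str_inj -> /code_str_inj ->]]]] //].
  by apply/He; exists s, t.
by have [X [HX1 HX2 HX3]] := W2R_preimage PhiP cons total YW2R; exists X.
Qed.
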